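(* Let $H$ be a projective Hopf algebra, $A$ and $B$ right $H$-comodule algebras, and $T:{}_A\underline{\mathcal{M}}^H\to{}_B\underline{\mathcal{M}}^H$ an $H$-colinear functor. Let $N=T(A)\in{}_B\mathcal{M}_A^H$ with right $A$-action $na=T(\varphi_A(a))(n)$, and let $\psi:F=N\otimes_A-\to T$ be the natural transformation $\psi_V(n\otimes_Av)=T(\varphi_V(v))(n)$, where $\varphi_V(v):A\to V$ is the map $\varphi_V(v)(a)=av$. Assume that $A$ is a generator of ${}_A\mathcal{M}^H$, and that $T$, viewed as a functor ${}_A\mathcal{M}^H\to{}_B\mathcal{M}^H$, preserves cokernels and arbitrary coproducts. Then $\psi$ is a natural isomorphism.
   Context: $k$ is a commutative ring, $H$ is a Hopf algebra over $k$ with bijective antipode $S$, projective as a $k$-module; $\otimes=\otimes_k$; right coactions $\rho(m)=m_{[0]}\otimes m_{[1]}$. ${}_A\mathcal{M}^H$: left $A$-modules and right $H$-comodules $M$ with $\rho(am)=a_{[0]}m_{[0]}\otimes a_{[1]}m_{[1]}$; morphisms are $A$-linear $H$-colinear maps. ${}_B\mathcal{M}_A^H$: $(B,A)$-bimodules with right $H$-coaction satisfying $\rho(bna)=b_{[0]}n_{[0]}a_{[0]}\otimes b_{[1]}n_{[1]}a_{[1]}$. For $M,N\in{}_A\mathcal{M}^H$, ${}_A{\rm HOM}(M,N)$ is the set of left $A$-linear $f:M\to N$ for which there is a (unique) $f_{[0]}\otimes f_{[1]}\in{}_A{\rm Hom}(M,N)\otimes H$ with $f_{[0]}(m)\otimes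 f_{[1]}=f(m_{[0]})_{[0]}\otimes S^{-1}(m_{[1]})f(m_{[0]})_{[1]}$ for all $m\in M$; it is a right $H$-comodule via $\rho(f)=f_{[0]}\otimes f_{[1]}$, and its coinvariants are the $A$-linear $H$-colinear maps. ${}_A\underline{\mathcal{M}}^H$ is the category with the same objects as ${}_A\mathcal{M}^H$ and morphism sets ${}_A{\rm HOM}(M,N)$. A functor $T:{}_A\underline{\mathcal{M}}^H\to{}_B\underline{\mathcal{M}}^H$ is $H$-colinear if all maps $T:{}_A{\rm HOM}(V,W)\to{}_B{\rm HOM}(T(V),T(W))$ are ($k$-linear and) right $H$-colinear; such a $T$ restricts to a functor ${}_A\mathcal{M}^H\to{}_B\mathcal{M}^H$. The maps $\varphi_V(v)$ lie in ${}_A{\rm HOM}(A,V)$. $N\otimes_AV$ carries the coaction $n_{[0]}\otimes v_{[0]}\otimes n_{[1]}v_{[1]}$. *)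

(* Defs.v *)
From HB Require Import structures.
From mathcomp Require Import ssreflect ssrfun ssrbool eqtype choice ssrnat seq.
From mathcomp Require Import bigop generic_quotient ssralg.
From mathcomp Require Import boolp functions.

Set Implicit Arguments.
Unset Strict Implicit.
Unset Printing Implicit Defensive.

Import GRing.Theory.
Local Open Scope ring_scope.
Local Open Scope quotient_scope.

(* For k-modules M and N on which the elements of X operate on the right and  *)
(* on the left respectively, [tensor ra la] is M \otimes_X N: finite formal   *)
(* sums of pairs (m, n), modulo additivity in both variables and              *)
(* (m x) \otimes n = m \otimes (x n).  The scalars of k act on the left       *)
(* factor; the relation carries a scalar c so that it is stable under that    *)
(* action whatever ra is.                                                     *)
Section Tensor.
Variables (k : comPzRingType) (M N : lmodType k) (X : Type).
Variables (ra : M -> X -> M) (la : X -> N -> N).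

Inductive tens_rel : seq (M * N) -> seq (M * N) -> Prop :=
| tens_refl s : tens_rel s s
| tens_sym s t : tens_rel s t -> tens_rel t s
| tens_trans s t u : tens_rel s t -> tens_rel t u -> tens_rel s u
| tens_cat s s' t t' :
    tens_rel s s' -> tens_rel t t' -> tens_rel (s ++ t) (s' ++ t')
| tens_catC s t : tens_rel (s ++ t) (t ++ s)
| tens_0l n : tens_rel [:: (0, n)] [::]
| tens_Dl m m' n : tens_rel [:: (m + m', n)] [:: (m, n); (m', n)]
| tens_Dr m n n' : tens_rel [:: (m, n + n')] [:: (m, n); (m, n')]
| tens_bal c m x n : tens_rel [:: (c *: ra m x, n)] [:: (c *: m, la x n)].

Definition tens_relb : rel (seq (M * N)) := fun s t => `[< tens_rel s t >].

Lemma tens_relb_refl : reflexive tens_relb.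
Proof. by move=> s; apply/asboolP; exact: tens_refl. Qed.

Lemma tens_relb_sym : symmetric tens_relb.
Proof. by move=> s t; apply/asboolP/asboolP; exact: tens_sym. Qed.

Lemma tens_relb_trans : transitive tens_relb.
Proof.
by move=> t s u /asboolP st /asboolP tu; apply/asboolP; exact: tens_trans tu.
Qed.

Canonical tens_equiv := EquivRel tens_relb tens_relb_refl tens_relb_sym
  tens_relb_trans.

Definition tensor := {eq_quot tens_equiv}.

HB.instance Definition _ := Choice.on tensor.

Definition tclass (s : seq (M * N)) : tensor := \pi_({eq_quot tens_equiv}) s.
Definition tpure (m : M) (n : N) : tensor := tclass [:: (m, n)].
Definition trepr (t : tensor) : seq (M * N) := repr (t : {eq_quot tens_equiv}).

Lemma treprK t : tclass (trepr t) = t.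
Proof. exact: reprK. Qed.

Lemma tclassP s t : tclass s = tclass t <-> tens_rel s t.
Proof.
split; first by move/eqmodP/asboolP.
by move=> st; apply/eqmodP/asboolP.
Qed.

Lemma trepr_rel s : tens_rel (trepr (tclass s)) s.
Proof. by apply/tclassP; rewrite treprK. Qed.

Definition tadd (s t : tensor) := tclass (trepr s ++ trepr t).
Definition tscale (c : k) (t : tensor) :=
  tclass [seq (c *: p.1, p.2) | p <- trepr t].

Lemma taddE s t : tadd (tclass s) (tclass t) = tclass (s ++ t).
Proof. by apply/tclassP; apply: tens_cat; exact: trepr_rel. Qed.

Lemma tens_rel_scale c s t : tens_rel s t ->
  tens_rel [seq (c *: p.1, p.2) | p <- s] [seq (c *: p.1, p.2) | p <- t].
Proof.
elim=> {s t} /=.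
- by move=> s; exact: tens_refl.
- by move=> s t _; exact: tens_sym.
- by move=> s t u _ st _; exact: tens_trans.
- by move=> s s' t t' _ ss' _ tt'; rewrite !map_cat; exact: tens_cat.
- by move=> s t; rewrite !map_cat; exact: tens_catC.
- by move=> n; rewrite scaler0; exact: tens_0l.
- by move=> m m' n; rewrite scalerDr; exact: tens_Dl.
- by move=> m n n'; exact: tens_Dr.
- by move=> d m x n; rewrite !scalerA; exact: tens_bal.
Qed.

Lemma tscaleE c s :
  tscale c (tclass s) = tclass [seq (c *: p.1, p.2) | p <- s].
Proof. by apply/tclassP; apply: tens_rel_scale; exact: trepr_rel. Qed.

Lemma tens_rel_N (m : M) (n : N) : tens_rel [:: (-1 *: m, n); (m, n)] [::].
Proof.
rewrite scaleN1r; apply: tens_trans (tens_sym (tens_Dl _ _ _)) _.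
by rewrite addNr; exact: tens_0l.
Qed.

Lemma taddA : associative tadd.
Proof.
move=> s t u; rewrite -[s]treprK -[t]treprK -[u]treprK.
by rewrite !taddE catA.
Qed.

Lemma taddC : commutative tadd.
Proof.
move=> s t; rewrite -[s]treprK -[t]treprK !taddE.
by apply/tclassP; exact: tens_catC.
Qed.

Lemma tadd0 : left_id (tclass [::]) tadd.
Proof. by move=> t; rewrite -[t]treprK taddE. Qed.

Lemma taddN : left_inverse (tclass [::]) (tscale (-1)) tadd.
Proof.
move=> t; rewrite -[t]treprK tscaleE taddE; apply/tclassP.
elim: (trepr t) => [|[m n] s IHs] /=; first exact: tens_refl.
set s' := [seq _ | _ <- s] in IHs *.
have h1 : tens_rel ((-1 *: m, n) :: s' ++ (m, n) :: s)
                   ([:: (-1 *: m, n); (m, n)] ++ (s' ++ s)).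
  apply: (@tens_cat [:: (-1 *: m, n)] [:: (-1 *: m, n)]).
    exact: tens_refl.
  have -> : s' ++ (m, n) :: s = (s' ++ [:: (m, n)]) ++ s by rewrite -catA.
  apply: (@tens_cat (s' ++ [:: (m, n)]) ((m, n) :: s') s s).
    exact: (@tens_catC s' [:: (m, n)]).
  exact: tens_refl.
apply: tens_trans h1 _.
by apply: (@tens_cat _ [::] _ [::]) => //; exact: tens_rel_N.
Qed.

HB.instance Definition _ :=
  GRing.isZmodule.Build tensor taddA taddC tadd0 taddN.

Lemma tclass_cat s t : tclass (s ++ t) = tclass s + tclass t.
Proof. by rewrite [RHS]taddE. Qed.

Lemma tscaleA a b t : tscale a (tscale b t) = tscale (a * b) t.
Proof.
rewrite -[t]treprK !tscaleE -map_comp; congr tclass.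
by apply: eq_map => -[m n] /=; rewrite scalerA.
Qed.

Lemma tscale1 : left_id 1 tscale.
Proof.
move=> t; rewrite -[t]treprK !tscaleE; congr tclass.
by rewrite -[RHS]map_id; apply: eq_map => -[m n] /=; rewrite scale1r.
Qed.

Lemma tscaleDr : right_distributive tscale +%R.
Proof.
move=> a s t; rewrite -[s]treprK -[t]treprK -tclass_cat !tscaleE.
by rewrite map_cat tclass_cat.
Qed.

Lemma tpure_Dl m m' n : tpure (m + m') n = tpure m n + tpure m' n.
Proof. by rewrite /tpure -tclass_cat; apply/tclassP; exact: tens_Dl. Qed.

Lemma tpure_Dr m n n' : tpure m (n + n') = tpure m n + tpure m n'.
Proof. by rewrite /tpure -tclass_cat; apply/tclassP; exact: tens_Dr. Qed.

Lemma tclass_cons p s : tclass (p :: s) = tpure p.1 p.2 + tclass s.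
Proof. by rewrite /tpure -tclass_cat; case: p. Qed.

Lemma tscaleDl t : {morph tscale^~ t : a b / a + b}.
Proof.
move=> a b; rewrite -[t]treprK !tscaleE.
elim: (trepr t) => [|p s IHs] /=; first exact: esym (addr0 _).
by rewrite !tclass_cons /= IHs scalerDl tpure_Dl addrACA.
Qed.

HB.instance Definition _ := GRing.Zmodule_isLmodule.Build k tensor
  tscaleA tscale1 tscaleDr tscaleDl.

Lemma tpure_Zl c m n : tpure (c *: m) n = c *: tpure m n.
Proof. by rewrite [RHS]tscaleE. Qed.

Lemma tpure_bal m x n : tpure (ra m x) n = tpure m (la x n).
Proof. by apply/tclassP; have := tens_bal 1 m x n; rewrite !scale1r. Qed.

(* A balanced map b induces the k-linear map [tlift b] out of the tensor      *)
(* product.  The definition evaluates b on a chosen representative, hence     *)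
(* makes sense for every b, but it is only meaningful when b is balanced.     *)
Definition tlift (P : lmodType k) (b : M -> N -> P) (t : tensor) : P :=
  \sum_(p <- trepr t) b p.1 p.2.

Definition balanced (P : lmodType k) (b : M -> N -> P) : Prop :=
  [/\ forall n, linear (b^~ n),
      forall m n n', b m (n + n') = b m n + b m n'
    & forall m x n, b (ra m x) n = b m (la x n)].

End Tensor.

Section LinearFacts.
Variables (k : comPzRingType) (M N P : lmodType k).

Section OneMap.
Variables (f : M -> N) (lf : linear f).

Lemma linD x y : f (x + y) = f x + f y.
Proof. by have := lf 1 x y; rewrite !scale1r. Qed.

Lemma lin0 : f 0 = 0.
Proof. by apply: (addrI (f 0)); rewrite -linD !addr0. Qed.

Lemma linZ c x : f (c *: x) = c *: f x.
Proof. by have := lf c x 0; rewrite !addr0 lin0 addr0. Qed.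

Lemma lin_sum (I : Type) (r : seq I) (F : I -> M) :
  f (\sum_(i <- r) F i) = \sum_(i <- r) f (F i).
Proof. by apply: (big_morph f); [exact: linD | exact: lin0]. Qed.

Lemma lin_comp (g : P -> M) : linear g -> linear (fun x => f (g x)).
Proof. by move=> lg c x y; rewrite lg lf. Qed.

End OneMap.

Lemma lin_id : linear (fun x : M => x).
Proof. by []. Qed.

Lemma lin_Z (c : k) (f : M -> N) : linear f -> linear (fun x => c *: f x).
Proof.
by move=> lf d x y; rewrite lf scalerDr !scalerA [c * d]mulrC.
Qed.

Lemma lin_Zl (f : M -> k^o) (n : N) : linear f -> linear (fun x => f x *: n).
Proof. by move=> lf d x y; rewrite lf scalerDl scalerA. Qed.

End LinearFacts.

Section TensorFacts.
Variables (k : comPzRingType) (M N : lmodType k) (X : Type).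
Variables (ra : M -> X -> M) (la : X -> N -> N).
Local Notation T := (tensor ra la).

Section Lift.
Variables (P : lmodType k) (b : M -> N -> P).

Lemma eq_tlift (b' : M -> N -> P) (t : T) :
  (forall m n, b m n = b' m n) -> tlift b t = tlift b' t.
Proof. by move=> bb'; apply: eq_bigr => p _; exact: bb'. Qed.

Hypothesis bb : balanced ra la b.

Lemma tlift_rel s t : tens_rel ra la s t ->
  \sum_(p <- s) b p.1 p.2 = \sum_(p <- t) b p.1 p.2.
Proof.
case: bb => lb ab xb; elim=> {s t} /=.
- by [].
- by move=> s t _ ->.
- by move=> s t u _ -> _ ->.
- by move=> s s' t t' _ ss' _ tt'; rewrite !big_cat /= ss' tt'.
- by move=> s t; rewrite !big_cat /= addrC.
- by move=> n; rewrite big_seq1 big_nil /= (lin0 (lb n)).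
- by move=> m m' n; rewrite !big_cons !big_nil /= !addr0 (linD (lb n)).
- by move=> m n n'; rewrite !big_cons !big_nil /= !addr0 ab.
- by move=> c m x n; rewrite !big_seq1 /= (linZ (lb n)) (linZ (lb _)) xb.
Qed.

Lemma tlift_class s : tlift b (tclass ra la s) = \sum_(p <- s) b p.1 p.2.
Proof. by apply: tlift_rel; exact: trepr_rel. Qed.

Lemma tlift_pure m n : tlift b (tpure ra la m n) = b m n.
Proof. by rewrite tlift_class big_seq1. Qed.

Lemma tlift_linear : linear (tlift b : T -> P).
Proof.
move=> c s t; rewrite -[s]treprK -[t]treprK.
rewrite [c *: _]tscaleE -tclass_cat !tlift_class big_cat big_map /= scaler_sumr.
congr (_ + _); apply: eq_bigr => p _; case: bb => lb _ _.
by rewrite (linZ (lb _)).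
Qed.

End Lift.

Lemma tens_sum (t : T) : t = \sum_(p <- trepr t) tpure ra la p.1 p.2.
Proof.
rewrite -{1}[t]treprK; elim: (trepr t) => [|p s IHs]; first by rewrite big_nil.
by rewrite big_cons tclass_cons IHs.
Qed.

Lemma lin_tlift_out (P Q : lmodType k) (f : P -> Q) (b : M -> N -> P) (t : T) :
  linear f -> f (tlift b t) = tlift (fun m n => f (b m n)) t.
Proof. by move=> lf; rewrite /tlift (lin_sum lf). Qed.

Lemma tens_ext (P : lmodType k) (f g : T -> P) : linear f -> linear g ->
  (forall m n, f (tpure ra la m n) = g (tpure ra la m n)) -> forall t, f t = g t.
Proof.
move=> lf lg fg t; rewrite (tens_sum t) (lin_sum lf) (lin_sum lg).
by apply: eq_bigr => p _.
Qed.

Lemma lin_tlift_arg (P Q : lmodType k) (b : M -> N -> P) (g : Q -> T) :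
  balanced ra la b -> linear g -> linear (fun x => tlift b (g x)).
Proof. by move=> bb lg; apply: lin_comp lg; exact: tlift_linear. Qed.

Lemma lin_tlift_fun (P Q : lmodType k) (b : Q -> M -> N -> P) (t : T) :
  (forall m n, linear (fun x => b x m n)) -> linear (fun x => tlift (b x) t).
Proof.
move=> lb c x y; rewrite /tlift scaler_sumr -big_split /=.
by apply: eq_bigr => p _; rewrite lb.
Qed.

Lemma lin_tpure_l (Q : lmodType k) (f : Q -> M) n :
  linear f -> linear (fun x => tpure ra la (f x) n).
Proof. by move=> lf c x y; rewrite lf tpure_Dl tpure_Zl. Qed.

Lemma balanced_tpure : balanced ra la (tpure ra la).
Proof.
split; first by move=> n; apply: lin_tpure_l.
  by move=> *; rewrite tpure_Dr.
by move=> *; rewrite tpure_bal.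
Qed.

End TensorFacts.

Lemma tlift_exch (k : comPzRingType) (M N M' N' P : lmodType k) (X X' : Type)
    (ra : M -> X -> M) (la : X -> N -> N)
    (ra' : M' -> X' -> M') (la' : X' -> N' -> N')
    (b : M -> N -> M' -> N' -> P) (s : tensor ra la) (t : tensor ra' la') :
  tlift (fun m n => tlift (b m n) t) s
    = tlift (fun m' n' => tlift (fun m n => b m n m' n') s) t.
Proof. by rewrite /tlift exchange_big. Qed.

Section KTensor.
Variable k : comPzRingType.
Implicit Types M N P Q : lmodType k.

Definition ktens M N : lmodType k :=
  tensor (fun (m : M) (c : k) => c *: m) (fun (c : k) (n : N) => c *: n).

Definition kpure M N (m : M) (n : N) : ktens M N := tpure _ _ m n.

Definition klift M N P (b : M -> N -> P) (t : ktens M N) : P := tlift b t.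

Definition bilin M N P (b : M -> N -> P) : Prop :=
  (forall n, linear (b^~ n)) /\ (forall m, linear (b m)).

End KTensor.

Arguments ktens {k} (M N)%_type_scope.

Notation "M ⊗ N" := (ktens M N) (at level 37, left associativity) : type_scope.
Notation "m ⊗ n" := (kpure m n) (at level 37, left associativity) : ring_scope.

Section KTensorMaps.
Variable k : comPzRingType.
Implicit Types M N P Q : lmodType k.

Definition tmap M N P Q (f : M -> P) (g : N -> Q) : M ⊗ N -> P ⊗ Q :=
  klift (fun m n => f m ⊗ g n).

Definition tassoc M N P : (M ⊗ N) ⊗ P -> M ⊗ (N ⊗ P) :=
  klift (fun t p => klift (fun m n => m ⊗ (n ⊗ p)) t).

Definition tmap2 M N M' N' P Q (f : M -> M' -> P) (g : N -> N' -> Q)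
    (s : M ⊗ N) (t : M' ⊗ N') : P ⊗ Q :=
  klift (fun m n => klift (fun m' n' => f m m' ⊗ g n n') t) s.

End KTensorMaps.

Section KTensorFacts.
Variable k : comPzRingType.
Implicit Types M N P Q : lmodType k.

Lemma bilin_balanced M N P (b : M -> N -> P) : bilin b ->
  balanced (fun (m : M) (c : k) => c *: m) (fun (c : k) (n : N) => c *: n) b.
Proof.
case=> bl br; split=> [//|m n n'|m c n]; first by rewrite (linD (br m)).
by rewrite (linZ (bl n)) (linZ (br m)).
Qed.

Lemma klift_pure M N P (b : M -> N -> P) m n :
  bilin b -> klift b (m ⊗ n) = b m n.
Proof. by move=> bb; rewrite /klift tlift_pure //; exact: bilin_balanced. Qed.

Lemma klift_linear M N P (b : M -> N -> P) : bilin b -> linear (klift b).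
Proof. by move=> bb; apply: tlift_linear; exact: bilin_balanced. Qed.

Lemma eq_klift M N P (b b' : M -> N -> P) t :
  (forall m n, b m n = b' m n) -> klift b t = klift b' t.
Proof. exact: eq_tlift. Qed.

Lemma klift_out M N P Q (f : P -> Q) (b : M -> N -> P) t :
  linear f -> f (klift b t) = klift (fun m n => f (b m n)) t.
Proof. exact: lin_tlift_out. Qed.

Lemma klift_klift M N M' N' P (b : M -> N -> P) (c : M' -> N' -> M ⊗ N) t :
  bilin b -> klift b (klift c t) = klift (fun m n => klift b (c m n)) t.
Proof. by move=> bb; rewrite klift_out //; exact: klift_linear. Qed.

Lemma klift_exch M N M' N' P (b : M -> N -> M' -> N' -> P) s t :
  klift (fun m n => klift (b m n) t) s
    = klift (fun m' n' => klift (fun m n => b m n m' n') s) t.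
Proof. exact: tlift_exch. Qed.

Lemma klift_kpure M N (t : M ⊗ N) : klift (fun m n => m ⊗ n) t = t.
Proof. by rewrite [RHS]tens_sum. Qed.

Lemma ktens_ext M N P (f g : M ⊗ N -> P) : linear f -> linear g ->
  (forall m n, f (m ⊗ n) = g (m ⊗ n)) -> forall t, f t = g t.
Proof. exact: tens_ext. Qed.

Lemma lin_klift_arg M N P Q (b : M -> N -> P) (g : Q -> M ⊗ N) :
  bilin b -> linear g -> linear (fun x => klift b (g x)).
Proof. by move=> bb lg; apply: lin_comp lg; exact: klift_linear. Qed.

Lemma lin_klift_fun M N P Q (b : Q -> M -> N -> P) t :
  (forall m n, linear (fun x => b x m n)) -> linear (fun x => klift (b x) t).
Proof. exact: lin_tlift_fun. Qed.

Lemma lin_kpure_l M N Q (f : Q -> M) (n : N) :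
  linear f -> linear (fun x => f x ⊗ n).
Proof. exact: lin_tpure_l. Qed.

Lemma lin_kpure_r M N Q (m : M) (f : Q -> N) :
  linear f -> linear (fun x => m ⊗ f x).
Proof.
move=> lf c x y; rewrite lf /kpure tpure_Dr; congr (_ + _).
by rewrite -[LHS](tpure_bal (fun (m : M) (c : k) => c *: m)) tpure_Zl.
Qed.

Lemma bilinP M N P (b : M -> N -> P) : (forall n, linear (fun m => b m n)) ->
  (forall m, linear (fun n => b m n)) -> bilin b.
Proof. by []. Qed.

End KTensorFacts.

Ltac lin_step :=
  lazymatch goal with
  | |- forall _, _ => intro
  | |- bilin _ => apply: bilinP
  | _ => first
    [ eassumption
    | exact: lin_id
    | apply: lin_kpure_l
    | apply: lin_kpure_r
    | apply: lin_klift_arg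
    | apply: lin_klift_fun
    | apply: lin_Zl
    | apply: lin_Z ]
  end.
Ltac lin := repeat lin_step.

Section MoreKTensorFacts.
Variable k : comPzRingType.
Implicit Types M N P Q : lmodType k.

Lemma tmap_pure M N P Q (f : M -> P) (g : N -> Q) m n :
  linear f -> linear g -> tmap f g (m ⊗ n) = f m ⊗ g n.
Proof. by move=> lf lg; rewrite /tmap klift_pure //; lin. Qed.

Lemma lin_tmap M N P Q (R : lmodType k) (f : M -> P) (g : N -> Q)
    (h : R -> M ⊗ N) :
  linear f -> linear g -> linear h -> linear (fun x => tmap f g (h x)).
Proof. by move=> lf lg lh; rewrite /tmap; lin. Qed.

Lemma klift_tmap M N P Q (R : lmodType k) (f : M -> P) (g : N -> Q)
    (b : P -> Q -> R) t : bilin b ->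
  klift b (tmap f g t) = klift (fun m n => b (f m) (g n)) t.
Proof.
move=> bb; rewrite /tmap klift_out; last exact: klift_linear.
by apply: eq_klift => m n; rewrite klift_pure.
Qed.

Lemma klift_tmap2 M N M' N' P Q (R : lmodType k) (f : M -> M' -> P)
    (g : N -> N' -> Q) (b : P -> Q -> R) s t : bilin b ->
  klift b (tmap2 f g s t)
    = klift (fun m n => klift (fun m' n' => b (f m m') (g n n')) t) s.
Proof.
move=> bb; rewrite /tmap2 klift_out; last exact: klift_linear.
apply: eq_klift => m n; rewrite klift_out; last exact: klift_linear.
by apply: eq_klift => m' n'; rewrite klift_pure.
Qed.

End MoreKTensorFacts.

(* Associative unital k-algebras.  The structure [algType k] of the library   *)
(* is not used because it forces 1 != 0.                                      *)
Record kalg (k : comPzRingType) := KAlg {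
  alg_mod :> lmodType k;
  amul : alg_mod -> alg_mod -> alg_mod;
  aone : alg_mod;
  amul_bilin : bilin amul;
  amulA : forall x y z, amul x (amul y z) = amul (amul x y) z;
  amul1l : forall x, amul aone x = x;
  amul1r : forall x, amul x aone = x }.

Arguments amul {k k0} : rename.
Arguments aone {k k0} : rename.
Notation "x ⊙ y" := (amul x y) (at level 40, left associativity) : ring_scope.

(* [is_comod D e rho]: rho is a right coaction on M of a coalgebra C with     *)
(* comultiplication D and counit e.                                           *)
Record is_comod (k : comPzRingType) (C M : lmodType k) (D : C -> C ⊗ C)
    (e : C -> k^o) (rho : M -> M ⊗ C) : Prop := IsComod {
  comod_linear : linear rho;
  comod_coassoc : forall m, tassoc (tmap rho id (rho m)) = tmap id D (rho m);
  comod_counit : forall m, klift (fun x h => e h *: x) (rho m) = m }.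

Record hopf (k : comPzRingType) := Hopf {
  hopf_alg :> kalg k;
  comul : hopf_alg -> hopf_alg ⊗ hopf_alg;
  counit : hopf_alg -> k^o;
  antip : hopf_alg -> hopf_alg;
  comul_comod : is_comod comul counit comul;
  counit_linear : linear counit;
  counit_l : forall h, klift (fun x y => counit x *: y) (comul h) = h;
  comul1 : comul aone = aone ⊗ aone;
  comulM : forall g h, comul (g ⊙ h) = tmap2 amul amul (comul g) (comul h);
  counit1 : counit aone = 1;
  counitM : forall g h, counit (g ⊙ h) = counit g * counit h;
  antip_linear : linear antip;
  antip_l : forall h, klift (fun x y => antip x ⊙ y) (comul h) = counit h *: (aone : hopf_alg);
  antip_r : forall h, klift (fun x y => x ⊙ antip y) (comul h) = counit h *: (aone : hopf_alg);
  antip_bij : bijective antip }.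

Arguments comul {k h0} : rename.
Arguments counit {k h0} : rename.
Arguments antip {k h0} : rename.

Definition projective (k : comPzRingType) (P : lmodType k) : Prop :=
  forall (M N : lmodType k) (g : {linear M -> N}) (f : {linear P -> N}),
    (forall y, exists x, g x = y) ->
    exists h : {linear P -> M}, forall x, g (h x) = f x.

Record is_lmod (k : comPzRingType) (A : kalg k) (M : lmodType k)
    (act : A -> M -> M) : Prop := IsLmod {
  lmod_bilin : bilin act;
  lmod_1 : forall m, act aone m = m;
  lmod_M : forall a b m, act (a ⊙ b) m = act a (act b m) }.

Record is_rmod (k : comPzRingType) (A : kalg k) (M : lmodType k)
    (act : M -> A -> M) : Prop := IsRmod {
  rmod_bilin : bilin act;
  rmod_1 : forall m, act m aone = m;
  rmod_M : forall m a b, act m (a ⊙ b) = act (act m a) b }.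

Section AlgebraFacts.
Variable k : comPzRingType.

Lemma lin_amul_l (A : kalg k) (Q : lmodType k) (f : Q -> A) (a : A) :
  linear f -> linear (fun x => f x ⊙ a).
Proof. by move=> lf; apply: (lin_comp ((amul_bilin A).1 a) lf). Qed.

Lemma lin_amul_r (A : kalg k) (Q : lmodType k) (f : Q -> A) (a : A) :
  linear f -> linear (fun x => a ⊙ f x).
Proof. by move=> lf; apply: (lin_comp ((amul_bilin A).2 a) lf). Qed.

Lemma lin_comul (H : hopf k) (Q : lmodType k) (f : Q -> H) :
  linear f -> linear (fun x => comul (f x)).
Proof. by move=> lf; apply: (lin_comp (comod_linear (comul_comod H)) lf). Qed.

Lemma lin_counit (H : hopf k) (Q : lmodType k) (f : Q -> H) :
  linear f -> linear (fun x => counit (f x)).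
Proof. by move=> lf; apply: (lin_comp (counit_linear (h0:=H)) lf). Qed.

Lemma lin_antip (H : hopf k) (Q : lmodType k) (f : Q -> H) :
  linear f -> linear (fun x => antip (f x)).
Proof. by move=> lf; apply: (lin_comp (antip_linear (h0:=H)) lf). Qed.

Lemma comod_sweedler (C M P : lmodType k) (D : C -> C ⊗ C) (e : C -> k^o)
    (rho : M -> M ⊗ C) (b : M -> C -> C -> P) (m : M) :
  is_comod D e rho ->
  linear D ->
  (forall g h, linear (fun x => b x g h)) ->
  (forall x, bilin (b x)) ->
  klift (fun x h => klift (fun y g => b y g h) (rho x)) (rho m)
    = klift (fun x h => klift (fun g g' => b x g g') (D h)) (rho m).
Proof.
move=> cr lD lb bb.
have b2 x g : linear (b x g) by case: (bb x).
have b1 x g : linear ((b x)^~ g) by case: (bb x).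
have lr := comod_linear cr.
pose L : M ⊗ (C ⊗ C) -> P := klift (fun x w => klift (b x) w).
have bL : bilin (fun x w => klift (b x) w) by lin.
have := congr1 L (comod_coassoc cr m).
rewrite /tassoc !klift_tmap; last first; try by lin.
rewrite /L klift_out; last exact: klift_linear.
rewrite klift_tmap // => <-; apply: eq_klift => x h /=.
rewrite klift_out; last exact: klift_linear.
by apply: eq_klift => y g; rewrite !klift_pure.
Qed.

End AlgebraFacts.

Ltac lin_step ::=
  lazymatch goal with
  | |- forall _, _ => intro
  | |- bilin _ => apply: bilinP
  | _ => first
    [ eassumption
    | exact: lin_id
    | apply: lin_kpure_l
    | apply: lin_kpure_r
    | apply: lin_klift_arg
    | apply: lin_klift_fun
    | apply: lin_amul_l
    | apply: lin_amul_r
    | apply: lin_comul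
    | apply: lin_counit
    | apply: lin_antip
    | apply: lin_Zl
    | apply: lin_Z ]
  end.

Section HopfFacts.
Variables (k : comPzRingType) (H : hopf k).

Lemma amulZl (A : kalg k) c (x y : A) : amul (c *: x) y = c *: amul x y.
Proof. by rewrite (linZ ((amul_bilin A).1 y)). Qed.

Lemma amulZr (A : kalg k) c (x y : A) : amul x (c *: y) = c *: amul x y.
Proof. by rewrite (linZ ((amul_bilin A).2 x)). Qed.

Lemma comul_sweedler (P : lmodType k) (b : H -> H -> H -> P) (h : H) :
  (forall g h, linear (fun x => b x g h)) -> (forall x, bilin (b x)) ->
  klift (fun x z => klift (fun y g => b y g z) (comul x)) (comul h)
    = klift (fun x z => klift (fun g g' => b x g g') (comul z)) (comul h).
Proof.
move=> lb bb; apply: comod_sweedler => //; first exact: comul_comod.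
exact: lin_comul.
Qed.

Lemma counitr (P : lmodType k) (f : H -> P) (h : H) : linear f ->
  klift (fun x y => counit y *: f x) (comul h) = f h.
Proof.
move=> lf; rewrite -[in RHS](comod_counit (comul_comod H) h) klift_out //.
by apply: eq_klift => x y; rewrite (linZ lf).
Qed.

Lemma counitl (P : lmodType k) (f : H -> P) (h : H) : linear f ->
  klift (fun x y => counit x *: f y) (comul h) = f h.
Proof.
move=> lf; rewrite -[in RHS](counit_l h) klift_out //.
by apply: eq_klift => x y; rewrite (linZ lf).
Qed.


Lemma antip_mulr (z h : H) :
  klift (fun x y => z ⊙ x ⊙ antip y) (comul h) = counit h *: z.
Proof.
under eq_klift => x y do rewrite -amulA.
rewrite -(klift_out (f := amul z)); last exact: lin_amul_r.
by rewrite antip_r amulZr amul1r.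
Qed.

Lemma antip_mull (z h : H) :
  klift (fun x y => z ⊙ antip x ⊙ y) (comul h) = counit h *: z.
Proof.
under eq_klift => x y do rewrite -amulA.
rewrite -(klift_out (f := amul z)); last exact: lin_amul_r.
by rewrite antip_l amulZr amul1r.
Qed.

Lemma antipM (g h : H) : antip (g ⊙ h) = antip h ⊙ antip g.
Proof.
pose body a a' g2 b b' h2 : H :=
  antip (a ⊙ b) ⊙ a' ⊙ b' ⊙ antip h2 ⊙ antip g2.
pose X := klift (fun g1 g2 => klift (fun a a' =>
  klift (fun h1 h2 => klift (fun b b' => body a a' g2 b b' h2) (comul h1))
    (comul h)) (comul g1)) (comul g).
transitivity X.
  rewrite /X (comul_sweedler
     (b := fun a a' g2 => klift (fun h1 h2 =>
        klift (fun b b' => body a a' g2 b b' h2) (comul h1)) (comul h)));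
    [|by rewrite /body; lin..].
  rewrite -(counitr (f := fun g => antip (g ⊙ h))); last by lin.
  apply: eq_klift => g1 g'.
  transitivity (klift (fun a a' => antip (g1 ⊙ h) ⊙ a ⊙ antip a') (comul g')).
    by rewrite antip_mulr.
  apply: eq_klift => a a'.
  rewrite (comul_sweedler (b := body g1 a a')); [|by rewrite /body; lin..].
  rewrite -(counitr (f := fun h => antip (g1 ⊙ h) ⊙ a ⊙ antip a')); last by lin.
  apply: eq_klift => h1 h'; rewrite /body -(klift_out (f := amul^~ (antip a'))).
    by rewrite antip_mulr amulZl.
  exact: lin_amul_l.
rewrite /X -(counitl (f := fun g => antip h ⊙ antip g)); last by lin.
apply: eq_klift => g1 g2.
rewrite klift_exch.
transitivity (klift (fun h1 h2 =>
    counit h1 *: (counit g1 *: (antip h2 ⊙ antip g2))) (comul h)); last first.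
  by rewrite (counitl (f := fun x => counit g1 *: (antip x ⊙ antip g2))); lin.
apply: eq_klift => h1 h2.
have : klift (fun a a' => klift (fun b b' =>
    antip (a ⊙ b) ⊙ (a' ⊙ b')) (comul h1)) (comul g1)
    = (counit g1 * counit h1) *: (aone : H).
  rewrite -counitM -antip_l comulM klift_tmap2 //; by lin.
move=> E1.
have E z : counit h1 *: (counit g1 *: z) = (counit g1 * counit h1) *: z.
  by rewrite scalerA mulrC.
rewrite E; pose f (z : H) := z ⊙ antip h2 ⊙ antip g2.
transitivity (f ((counit g1 * counit h1) *: (aone : H))); last first.
  by rewrite /f !amulZl amul1l.
have lf : linear f by rewrite /f; lin.
rewrite -E1 klift_out //; apply: eq_klift => a a'.
rewrite klift_out //; apply: eq_klift => b b'.
by rewrite /body /f !amulA.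
Qed.

Lemma antip1 : antip (aone : H) = aone.
Proof.
have := antip_l (aone : H); rewrite comul1 counit1 scale1r klift_pure.
  by rewrite amul1r.
by lin.
Qed.

Lemma antip_inv_ex : exists f : H -> H, cancel antip f /\ cancel f antip.
Proof. by case: (@antip_bij _ H) => f; exists f. Qed.

Definition antipV : H -> H := sval (cid antip_inv_ex).

Lemma antipK : cancel antip antipV.
Proof. by rewrite /antipV; case: cid => f []. Qed.

Lemma antipVK : cancel antipV antip.
Proof. by rewrite /antipV; case: cid => f []. Qed.

Lemma antip_inj : injective (@antip k H).
Proof. exact: can_inj antipK. Qed.

Lemma antipV_linear : linear antipV.
Proof.
by move=> c x y; apply: antip_inj; rewrite antip_linear !antipVK.
Qed.

Lemma lin_antipV (Q : lmodType k) (f : Q -> H) :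
  linear f -> linear (fun x => antipV (f x)).
Proof. by move=> lf; apply: (lin_comp antipV_linear lf). Qed.

Lemma antipV1 : antipV aone = aone.
Proof. by apply: antip_inj; rewrite antipVK antip1. Qed.

Lemma antipVM (g h : H) : antipV (g ⊙ h) = antipV h ⊙ antipV g.
Proof. by apply: antip_inj; rewrite antipM !antipVK. Qed.

Lemma antipV_l (h : H) :
  klift (fun x y => antipV y ⊙ x) (comul h) = counit h *: (aone : H).
Proof.
apply: antip_inj; rewrite klift_out; last exact: antip_linear.
rewrite (linZ (@antip_linear _ H)) antip1 -antip_l.
by apply: eq_klift => x y; rewrite antipM antipVK.
Qed.

Lemma antipV_r (h : H) :
  klift (fun x y => y ⊙ antipV x) (comul h) = counit h *: (aone : H).
Proof.
apply: antip_inj; rewrite klift_out; last exact: antip_linear.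
rewrite (linZ (@antip_linear _ H)) antip1 -antip_r.
by apply: eq_klift => x y; rewrite antipM antipVK.
Qed.

End HopfFacts.

Arguments antipV {k H}.

Record comodAlg (k : comPzRingType) (H : hopf k) := ComodAlg {
  ca_alg :> kalg k;
  ca_rho : ca_alg -> ca_alg ⊗ H;
  ca_comod : is_comod comul counit ca_rho;
  ca_rho1 : ca_rho aone = aone ⊗ aone;
  ca_rhoM : forall a b, ca_rho (a ⊙ b) = tmap2 amul amul (ca_rho a) (ca_rho b)
}.

Arguments ca_rho {k H c} : rename.

(* objects of {}_A M^H                                                        *)
Record relmod (k : comPzRingType) (H : hopf k) (A : comodAlg H) := RelMod {
  rm_mod :> lmodType k;
  lact : A -> rm_mod -> rm_mod;
  rho : rm_mod -> rm_mod ⊗ H;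
  rm_lmod : is_lmod lact;
  rm_comod : is_comod comul counit rho;
  rm_rhoM : forall a m, rho (lact a m) = tmap2 lact amul (ca_rho a) (rho m) }.

Arguments lact {k H A r} : rename.
Arguments rho {k H A r} : rename.
Notation "a ▷ m" := (lact a m) (at level 40, left associativity) : ring_scope.


Section RelmodFacts.
Variables (k : comPzRingType) (H : hopf k) (A : comodAlg H).
Implicit Types V W : relmod A.

Lemma lin_lact_l V (Q : lmodType k) (f : Q -> A) (v : V) :
  linear f -> linear (fun x => f x ▷ v).
Proof. by move=> lf; apply: (lin_comp ((lmod_bilin (rm_lmod V)).1 v) lf). Qed.

Lemma lin_lact_r V (Q : lmodType k) (f : Q -> V) (a : A) :
  linear f -> linear (fun x => a ▷ f x).
Proof. by move=> lf; apply: (lin_comp ((lmod_bilin (rm_lmod V)).2 a) lf). Qed.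

Lemma lin_rho V (Q : lmodType k) (f : Q -> V) :
  linear f -> linear (fun x => rho (f x)).
Proof. by move=> lf; apply: (lin_comp (comod_linear (rm_comod V)) lf). Qed.

Lemma lin_ca_rho (Q : lmodType k) (f : Q -> A) :
  linear f -> linear (fun x => ca_rho (f x)).
Proof. by move=> lf; apply: (lin_comp (comod_linear (ca_comod A)) lf). Qed.

Lemma lact1 V (v : V) : aone ▷ v = v.
Proof. exact: lmod_1 (rm_lmod V) v. Qed.

Lemma lactM V a b (v : V) : (a ⊙ b) ▷ v = a ▷ (b ▷ v).
Proof. exact: lmod_M (rm_lmod V) a b v. Qed.

Lemma rho_sweedler V (P : lmodType k) (b : V -> H -> H -> P) (v : V) :
  (forall g h, linear (fun x => b x g h)) -> (forall x, bilin (b x)) ->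
  klift (fun x h => klift (fun y g => b y g h) (rho x)) (rho v)
    = klift (fun x h => klift (fun g g' => b x g g') (comul h)) (rho v).
Proof.
move=> lb bb; apply: comod_sweedler => //; first exact: rm_comod.
exact: lin_comul.
Qed.

Lemma rho_counit V (P : lmodType k) (f : V -> P) (v : V) : linear f ->
  klift (fun x h => counit h *: f x) (rho v) = f v.
Proof.
move=> lf; rewrite -[in RHS](comod_counit (rm_comod V) v) klift_out //.
by apply: eq_klift => x y; rewrite (linZ lf).
Qed.

End RelmodFacts.

Ltac lin_step ::=
  lazymatch goal with
  | |- forall _, _ => intro
  | |- bilin _ => apply: bilinP
  | _ => first
    [ eassumption
    | exact: lin_id
    | apply: lin_kpure_l
    | apply: lin_kpure_r
    | apply: lin_klift_arg
    | apply: lin_klift_fun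
    | apply: lin_amul_l
    | apply: lin_amul_r
    | apply: lin_lact_l
    | apply: lin_lact_r
    | apply: lin_rho
    | apply: lin_ca_rho
    | apply: lin_comul
    | apply: lin_counit
    | apply: lin_antip
    | apply: lin_antipV
    | apply: lin_Zl
    | apply: lin_Z ]
  end.

(* dcoact f m = f(m_0)_0 \otimes S^-1(m_1) f(m_0)_1                           *)
Definition dcoact (k : comPzRingType) (H : hopf k) (A : comodAlg H)
    (V W : relmod A) (f : V -> W) (m : V) : W ⊗ H :=
  klift (fun m0 m1 =>
    klift (fun n0 n1 => n0 ⊗ (antipV m1 ⊙ n1)) (rho (f m0))) (rho m).

Section Dcoact.
Variables (k : comPzRingType) (H : hopf k) (A : comodAlg H).
Variables (V W : relmod A) (E : lmodType k) (ev : E -> V -> W).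
Hypothesis lev : bilin ev.
Variables (f : V -> W) (t : E ⊗ H).
Hypothesis lf : linear f.

Lemma lin_comp_f (Q : lmodType k) (g : Q -> V) :
  linear g -> linear (fun x => f (g x)).
Proof. exact: lin_comp. Qed.

Lemma lin_ev_l (Q : lmodType k) (g : Q -> E) v :
  linear g -> linear (fun x => ev (g x) v).
Proof. by move=> lg; apply: (lin_comp (lev.1 v)). Qed.

Lemma lin_ev_r (Q : lmodType k) e (g : Q -> V) :
  linear g -> linear (fun x => ev e (g x)).
Proof. by move=> lg; apply: (lin_comp (lev.2 e)). Qed.

(* f(m)_0 \otimes f(m)_1 = f_0(m_0) \otimes m_1 f_1                           *)
Lemma dcoactP :
  (forall m, tmap (ev^~ m) id t = dcoact f m) <->
  (forall m, rho (f m) =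
     klift (fun m0 m1 => klift (fun g h => ev g m0 ⊗ (m1 ⊙ h)) t) (rho m)).
Proof.
split=> [E1 m|E1 m].
  have E2 m0 m1 : klift (fun g h => ev g m0 ⊗ (m1 ⊙ h)) t
      = klift (fun w h => w ⊗ (m1 ⊙ h)) (dcoact f m0).
    by rewrite -E1 klift_tmap //; lin.
  rewrite -(rho_counit (f := fun m => rho (f m))); last first.
    by apply: lin_rho; exact: lin_comp_f.
  under [RHS]eq_klift => m0 m1.
    rewrite E2 /dcoact klift_klift; last by lin.
    under eq_klift => a b.
      rewrite klift_klift; last by lin.
      under eq_klift => c d do (rewrite klift_pure; last by lin).
      over.
    over.
  rewrite (rho_sweedler (b := fun m0 x y =>
    klift (fun c d => c ⊗ (y ⊙ (antipV x ⊙ d))) (rho (f m0)))); last by lin.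
    apply: eq_klift => m0 m1; rewrite klift_exch.
    rewrite -[X in _ *: X]klift_kpure klift_out; last exact: lin_Z.
    apply: eq_klift => c d.
    under [RHS]eq_klift => x y do rewrite amulA.
    have l : linear (fun z : H => c ⊗ (z ⊙ d)) by lin.
    rewrite -(klift_out (f := fun z => c ⊗ (z ⊙ d))) // antipV_r.
    by rewrite (linZ l) amul1l.
  by move=> g h; apply: lin_klift_arg; [lin | apply: lin_rho; exact: lin_comp_f].
transitivity (klift (fun g h => ev g m ⊗ h) t); first by [].
have l1 : linear (fun m => klift (fun g h => ev g m ⊗ h) t).
  by apply: lin_klift_fun => g h; apply: lin_kpure_l; exact: lin_ev_r.
rewrite /dcoact -(rho_counit (f := fun m => klift (fun g h => ev g m ⊗ h) t)) //.
under [RHS]eq_klift => m0 m1.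
  rewrite E1 klift_klift; last by lin.
  under eq_klift => a b.
    rewrite klift_klift; last by lin.
    under eq_klift => c d do (rewrite klift_pure; last by lin).
    over.
  over.
rewrite (rho_sweedler (b := fun a b m1 =>
  klift (fun g h => ev g a ⊗ (antipV m1 ⊙ (b ⊙ h))) t)).
- apply: eq_klift => m0 m1; rewrite klift_exch.
  rewrite klift_out; last exact: lin_Z.
  apply: eq_klift => g h.
  under [RHS]eq_klift => x y do rewrite amulA.
  have l : linear (fun z : H => ev g m0 ⊗ (z ⊙ h)) by lin.
  rewrite -(klift_out (f := fun z => ev g m0 ⊗ (z ⊙ h))) // antipV_l.
  by rewrite (linZ l) amul1l.
- by move=> g h; apply: lin_klift_fun => c d; apply: lin_kpure_l; exact: lin_ev_r.
- by lin.
Qed.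

End Dcoact.

Section Homs.
Variables (k : comPzRingType) (H : hopf k) (A : comodAlg H).
Implicit Types V W : relmod A.

(* {}_A Hom(V, W) *)
Definition alin V W : {pred V -> W} :=
  fun f => `[< linear f /\ forall a v, f (a ▷ v) = a ▷ f v >].

Lemma alin_submod V W : submod_closed (@alin V W).
Proof.
split=> [|c f g /asboolP[lf af] /asboolP[lg ag]]; apply/asboolP.
  split=> [c x y|a v]; rewrite /GRing.zero/=; first by rewrite scaler0 addr0.
  by rewrite (lin0 (lin_lact_r a (@lin_id _ _))).
split=> [|a v].
  have lfg: linear (fun x => c *: f x + g x).
    by move=> d x y; rewrite (lin_Z c lf) lg scalerDr addrACA.
  exact: lfg.
have E : (c *: f + g) = (fun x => c *: f x + g x) by [].
by rewrite E af ag (lin_lact_r a (@lin_id _ _)).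
Qed.

HB.instance Definition _ V W :=
  GRing.isSubmodClosed.Build k (V -> W) (@alin V W) (@alin_submod V W).

Record ahom V W := AHom { ahom_fun :> V -> W; ahomP : ahom_fun \in @alin V W }.

HB.instance Definition _ V W := [isSub for @ahom_fun V W].
HB.instance Definition _ V W := [Choice of ahom V W by <:].
HB.instance Definition _ V W := [SubChoice_isSubLmodule of ahom V W by <:].

Section AhomFacts.
Variables V W : relmod A.
Implicit Types f g : ahom V W.

Lemma ahom_ext f g : (forall v, f v = g v) -> f = g.
Proof. by move=> fg; apply: val_inj; apply/funext. Qed.

Lemma ahom_linear f : linear f.
Proof. by case: f => f /= /asboolP[]. Qed.

Lemma ahom_act f a v : f (a ▷ v) = a ▷ f v.
Proof. by case: f => f /= /asboolP[]. Qed.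

Lemma ahom_ev_linear v : linear (fun f : ahom V W => f v).
Proof. by []. Qed.

Lemma ahom_ev_bilin : bilin (fun f : ahom V W => (f : V -> W)).
Proof. by split=> [v|f]; [exact: ahom_ev_linear | exact: ahom_linear]. Qed.

Lemma lin_ahom (Q : lmodType k) f (g : Q -> V) :
  linear g -> linear (fun x => f (g x)).
Proof. by move=> lg; exact: (lin_comp (ahom_linear f) lg). Qed.

Lemma lin_ahom_ev (Q : lmodType k) (g : Q -> ahom V W) v :
  linear g -> linear (fun x => g x v).
Proof. by move=> lg; exact: (lin_comp (ahom_ev_linear v) lg). Qed.

End AhomFacts.

Lemma alinP V W (f : V -> W) : linear f -> (forall a v, f (a ▷ v) = a ▷ f v) ->
  f \in @alin V W.
Proof. by move=> lf af; apply/asboolP. Qed.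

Definition ahom_id V : ahom V V := AHom (alinP (@lin_id k V) (fun _ _ => erefl)).

Lemma ahom_comp_alin V W X (g : ahom W X) (f : ahom V W) :
  (fun v => g (f v)) \in @alin V X.
Proof.
apply: alinP => [|a v]; last by rewrite !ahom_act.
by apply: lin_ahom; exact: ahom_linear.
Qed.

Definition ahom_comp V W X (g : ahom W X) (f : ahom V W) : ahom V X :=
  AHom (ahom_comp_alin g f).

Lemma lin_ahom_comp_l V W X (Q : lmodType k) (g : Q -> ahom W X) (f : ahom V W) :
  linear g -> linear (fun x => ahom_comp (g x) f).
Proof. by move=> lg c x y; apply: ahom_ext => v; rewrite /= lg. Qed.

Lemma lin_ahom_comp_r V W X (Q : lmodType k) (g : ahom W X) (f : Q -> ahom V W) :
  linear f -> linear (fun x => ahom_comp g (f x)).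
Proof.
by move=> lf c x y; apply: ahom_ext => v; rewrite /= lf; apply: ahom_linear.
Qed.

(* {}_A HOM(V, W) *)
Definition rational V W : {pred ahom V W} := fun f =>
  `[< exists t : ahom V W ⊗ H,
        forall m, tmap (fun g : ahom V W => g m) id t = dcoact f m >].

Lemma dcoact_linear V W m : linear (fun f : ahom V W => dcoact f m).
Proof.
rewrite /dcoact; apply: lin_klift_fun => m0 m1; apply: lin_klift_arg.
  by lin.
by apply: lin_rho; apply: lin_ahom_ev; exact: lin_id.
Qed.

Lemma rational_submod V W : submod_closed (@rational V W).
Proof.
have lt m : linear (tmap (fun g : ahom V W => g m) (@id H)).
  by apply: lin_tmap; [exact: ahom_ev_linear | exact: lin_id | exact: lin_id].
split=> [|c f g /asboolP[s sP] /asboolP[t tP]]; apply/asboolP.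
  by exists 0 => m; rewrite (lin0 (lt m)) (lin0 (dcoact_linear _)).
by exists (c *: s + t) => m; rewrite lt sP tP -dcoact_linear.
Qed.

HB.instance Definition _ V W :=
  GRing.isSubmodClosed.Build k (ahom V W) (@rational V W) (@rational_submod V W).

Record aHOM V W :=
  AHOM { aHOM_ahom :> ahom V W; aHOMP : aHOM_ahom \in @rational V W }.

HB.instance Definition _ V W := [isSub for @aHOM_ahom V W].
HB.instance Definition _ V W := [Choice of aHOM V W by <:].
HB.instance Definition _ V W := [SubChoice_isSubLmodule of aHOM V W by <:].

(* The coaction of {}_A HOM(V, W): [HOM_coact f t] means that the element     *)
(* t = f_0 \otimes f_1 of {}_A HOM(V, W) \otimes H satisfies                  *)
(* f_0(m) \otimes f_1 = f(m_0)_0 \otimes S^-1(m_1) f(m_0)_1 for all m.  When H *)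
(* is projective over k there is exactly one such t for each f.               *)
Definition HOM_coact V W (f : aHOM V W) (t : aHOM V W ⊗ H) : Prop :=
  forall m, tmap (fun g : aHOM V W => g m) id t = dcoact f m.

(* morphisms of {}_A M^H *)
Definition colinear V W : {pred ahom V W} := fun f =>
  `[< forall v, rho (f v) = tmap f id (rho v) >].

Lemma colinear_submod V W : submod_closed (@colinear V W).
Proof.
split=> [|c f g /asboolP fP /asboolP gP]; apply/asboolP => v.
  transitivity (0 : W ⊗ H); first exact: (lin0 (lin_rho (@lin_id _ _))).
  rewrite /tmap /klift /tlift big1 // => p _.
  exact: (lin0 (lin_kpure_l p.2 (@lin_id _ _))).
transitivity (c *: rho (f v) + rho (g v)).
  exact: (lin_rho (@lin_id _ _)).
rewrite fP gP /tmap /klift /tlift scaler_sumr -big_split /=.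
apply: eq_bigr => p _; symmetry; exact: (lin_kpure_l p.2 (@lin_id _ _)).
Qed.

HB.instance Definition _ V W :=
  GRing.isSubmodClosed.Build k (ahom V W) (@colinear V W) (@colinear_submod V W).

Record amor V W :=
  AMor { amor_ahom :> ahom V W; amorP : amor_ahom \in @colinear V W }.

HB.instance Definition _ V W := [isSub for @amor_ahom V W].
HB.instance Definition _ V W := [Choice of amor V W by <:].
HB.instance Definition _ V W := [SubChoice_isSubLmodule of amor V W by <:].

End Homs.

Record kcat (k : comPzRingType) := KCat {
  obj :> Type;
  hom : obj -> obj -> lmodType k;
  idm : forall X, hom X X;
  comp : forall X Y Z, hom Y Z -> hom X Y -> hom X Z;
  comp_bilin : forall X Y Z, bilin (@comp X Y Z);
  compA : forall X Y Z W (h : hom Z W) (g : hom Y Z) (f : hom X Y),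
    comp h (comp g f) = comp (comp h g) f;
  comp1l : forall X Y (f : hom X Y), comp (idm Y) f = f;
  comp1r : forall X Y (f : hom X Y), comp f (idm X) = f }.

Arguments hom {k k0} X Y : rename.
Arguments idm {k k0} X : rename.
Arguments comp {k k0 X Y Z} g f : rename.

Record functor (k : comPzRingType) (C D : kcat k) := Functor {
  fobj :> C -> D;
  fmap : forall X Y : C, hom X Y -> hom (fobj X) (fobj Y);
  fmap_id : forall X, fmap (idm X) = idm (fobj X);
  fmap_comp : forall X Y Z (g : hom Y Z) (f : hom X Y),
    fmap (comp g f) = comp (fmap g) (fmap f) }.

Arguments fmap {k C D} f {X Y} _ : rename.

Section CategoryNotions.
Variable k : comPzRingType.
Implicit Types C D : kcat k.

Definition is_iso C (X Y : C) (f : hom X Y) : Prop :=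
  exists g : hom Y X, comp g f = idm X /\ comp f g = idm Y.

Definition natural C D (F G : functor C D) (eta : forall X, hom (F X) (G X)) :
    Prop :=
  forall (X Y : C) (f : hom X Y), comp (eta Y) (fmap F f) = comp (fmap G f) (eta X).

Definition natural_iso C D (F G : functor C D)
    (eta : forall X, hom (F X) (G X)) : Prop :=
  natural eta /\ forall X, is_iso (eta X).

Definition generator C (G : C) : Prop :=
  forall (X Y : C) (f g : hom X Y),
    (forall h : hom G X, comp f h = comp g h) -> f = g.

Definition is_cokernel C (X Y Q : C) (f : hom X Y) (q : hom Y Q) : Prop :=
  comp q f = 0 /\
  forall (Z : C) (g : hom Y Z), comp g f = 0 -> exists! h : hom Q Z, comp h q = g.

Definition is_coproduct C (I : Type) (X : I -> C) (P : C)
    (inj : forall i, hom (X i) P) : Prop :=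
  forall (Z : C) (g : forall i, hom (X i) Z),
    exists! h : hom P Z, forall i, comp h (inj i) = g i.

Definition preserves_cokernels C D (F : functor C D) : Prop :=
  forall (X Y Q : C) (f : hom X Y) (q : hom Y Q),
    is_cokernel f q -> is_cokernel (fmap F f) (fmap F q).

Definition preserves_coproducts C D (F : functor C D) : Prop :=
  forall (I : Type) (X : I -> C) (P : C) (inj : forall i, hom (X i) P),
    is_coproduct inj -> is_coproduct (fun i => fmap F (inj i)).

End CategoryNotions.

Ltac lin_step ::=
  lazymatch goal with
  | |- forall _, _ => intro
  | |- bilin _ => apply: bilinP
  | _ => first
    [ eassumption
    | exact: lin_id
    | apply: lin_kpure_l
    | apply: lin_kpure_r
    | apply: lin_klift_arg
    | apply: lin_klift_fun
    | apply: lin_amul_l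
    | apply: lin_amul_r
    | apply: lin_lact_l
    | apply: lin_lact_r
    | apply: lin_rho
    | apply: lin_ca_rho
    | apply: lin_comul
    | apply: lin_counit
    | apply: lin_antip
    | apply: lin_antipV
    | apply: lin_ahom_ev
    | apply: lin_ahom
    | apply: lin_Zl
    | apply: lin_Z ]
  end.

Section RelCat.
Variables (k : comPzRingType) (H : hopf k) (A : comodAlg H).
Implicit Types V W X : relmod A.

Lemma aHOM_ext V W (f g : aHOM V W) : (forall v, f v = g v) -> f = g.
Proof. by move=> fg; apply: val_inj; apply: ahom_ext. Qed.

Lemma amor_ext V W (f g : amor V W) : (forall v, f v = g v) -> f = g.
Proof. by move=> fg; apply: val_inj; apply: ahom_ext. Qed.

Lemma lin_aHOM_ahom V W (Q : lmodType k) (f : Q -> aHOM V W) :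
  linear f -> linear (fun x => aHOM_ahom (f x)).
Proof. by move=> lf c x y; rewrite lf. Qed.

Lemma rationalP V W (f : ahom V W) : f \in @rational k H A V W <->
  exists t : ahom V W ⊗ H, forall m, rho (f m) =
    klift (fun m0 m1 => klift (fun g h => (g : ahom V W) m0 ⊗ (m1 ⊙ h)) t) (rho m).
Proof.
split=> [/asboolP[t tP]|[t tP]].
  exists t; apply/(dcoactP (@ahom_ev_bilin k H A V W)) => //.
  exact: ahom_linear.
apply/asboolP; exists t; apply/(dcoactP (@ahom_ev_bilin k H A V W)) => //.
exact: ahom_linear.
Qed.

Lemma HOM_coactP V W (f : aHOM V W) (t : aHOM V W ⊗ H) : HOM_coact f t <->
  forall m, rho (f m) =
    klift (fun m0 m1 => klift (fun g h => (g : aHOM V W) m0 ⊗ (m1 ⊙ h)) t) (rho m).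
Proof.
have b : bilin (fun f : aHOM V W => (f : V -> W)).
  by split=> [v|g]; [|exact: ahom_linear].
exact: (dcoactP b t (@ahom_linear _ _ _ _ _ f)).
Qed.

Lemma colinearP V W (f : ahom V W) : f \in @colinear k H A V W <->
  forall v, rho (f v) = tmap f id (rho v).
Proof. by split=> [/asboolP|fP]; last apply/asboolP. Qed.

Lemma colinear_rational V W (f : ahom V W) :
  f \in @colinear k H A V W -> f \in @rational k H A V W.
Proof.
move/colinearP => fP; apply/rationalP; exists (f ⊗ aone) => m.
rewrite fP; apply: eq_klift => m0 m1; rewrite klift_pure ?amul1r //.
by lin.
Qed.

Definition amor_HOM V W (f : amor V W) : aHOM V W :=
  AHOM (colinear_rational (amorP f)).

Lemma amor_coact V W (f : amor V W) : HOM_coact (amor_HOM f) (amor_HOM f ⊗ aone).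
Proof.
apply/HOM_coactP => m; have /colinearP -> := amorP f.
apply: eq_klift => m0 m1; rewrite klift_pure ?amul1r //.
by apply: bilinP => [n|g]; [apply: lin_kpure_l | lin].
Qed.

Lemma coact_colinear V W (f : aHOM V W) :
  HOM_coact f (f ⊗ aone) -> aHOM_ahom f \in @colinear k H A V W.
Proof.
move/HOM_coactP => fP; apply/colinearP => m; rewrite fP.
apply: eq_klift => m0 m1; rewrite klift_pure ?amul1r //.
by apply: bilinP => [n|g]; [apply: lin_kpure_l | lin].
Qed.

Lemma colinear_id V : ahom_id V \in @colinear k H A V V.
Proof. by apply/colinearP => v; rewrite /tmap [LHS]/= klift_kpure. Qed.

Lemma colinear_comp V W X (g : amor W X) (f : amor V W) :
  ahom_comp g f \in @colinear k H A V X.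
Proof.
apply/colinearP => v /=; have /colinearP -> := amorP g.
have /colinearP -> := amorP f; rewrite [LHS]/tmap klift_tmap //.
by lin.
Qed.

Lemma rational_comp V W X (g : aHOM W X) (f : aHOM V W) :
  ahom_comp g f \in @rational k H A V X.
Proof.
have /rationalP[s sP] := aHOMP g; have /rationalP[t tP] := aHOMP f.
have bl : bilin (fun (f : ahom V W) (h : H) =>
    klift (fun g l => ahom_comp g f ⊗ (h ⊙ l)) s).
  apply: bilinP => [h|u]; last by lin.
  apply: lin_klift_fun => g' l; apply: lin_kpure_l.
  exact: (lin_ahom_comp_r g' (@lin_id _ _)).
apply/rationalP.
exists (klift (fun f h => klift (fun g l => ahom_comp g f ⊗ (h ⊙ l)) s) t) => m.
rewrite /= sP tP klift_klift; last by lin.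
apply: eq_klift => m0 m1; rewrite klift_klift; last by lin.
rewrite klift_klift; last by lin.
apply: eq_klift => f' h; rewrite klift_pure; last by lin.
rewrite klift_klift; last by lin.
apply: eq_klift => g' l; rewrite klift_pure ?amulA //; by lin.
Qed.

Definition amor_id V : amor V V := AMor (colinear_id V).
Definition amor_comp V W X (g : amor W X) (f : amor V W) : amor V X :=
  AMor (colinear_comp g f).
Definition aHOM_id V : aHOM V V := amor_HOM (amor_id V).
Definition aHOM_comp V W X (g : aHOM W X) (f : aHOM V W) : aHOM V X :=
  AHOM (rational_comp g f).

Lemma amor_comp_bilin V W X : bilin (@amor_comp V W X).
Proof.
split=> g c x y; apply: amor_ext => v //=; exact: (ahom_linear g).
Qed.

Lemma aHOM_comp_bilin V W X : bilin (@aHOM_comp V W X).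
Proof.
split=> g c x y; apply: aHOM_ext => v //=; exact: (ahom_linear g).
Qed.

(* the category {}_A M^H *)
Definition relC : kcat k.
Proof.
refine (@KCat k (relmod A) (fun V W => amor V W) amor_id amor_comp
  amor_comp_bilin _ _ _).
- by move=> V W X Y h g f; exact: amor_ext.
- by move=> V W f; exact: amor_ext.
- by move=> V W f; exact: amor_ext.
Defined.

(* the category {}_A \underline{M}^H *)
Definition urelC : kcat k.
Proof.
refine (@KCat k (relmod A) (fun V W => aHOM V W) aHOM_id aHOM_comp
  aHOM_comp_bilin _ _ _).
- by move=> V W X Y h g f; exact: aHOM_ext.
- by move=> V W f; exact: aHOM_ext.
- by move=> V W f; exact: aHOM_ext.
Defined.

Definition regular : relmod A.
Proof.
refine (@RelMod k H A A (@amul k A) (@ca_rho k H A) _ (ca_comod A) (@ca_rhoM k H A)).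
by split; [exact: amul_bilin | exact: amul1l | move=> *; rewrite amulA].
Defined.

(* \varphi_V(v) : A -> V, a |-> a v *)
Lemma phi_alin V (v : V) : (fun a : regular => (a : A) ▷ v) \in @alin k H A regular V.
Proof.
by apply: alinP => [|a b]; [exact: (lin_lact_l v (@lin_id _ A)) | exact: lactM].
Qed.

Definition phi_ahom V (v : V) : ahom regular V := AHom (phi_alin v).

Lemma phi_ahom_linear V : linear (@phi_ahom V).
Proof. by move=> c x y; apply: ahom_ext => a /=; apply: lin_lact_r (@lin_id _ _) _ _ _. Qed.

Lemma phi_rational V (v : V) : phi_ahom v \in @rational k H A regular V.
Proof.
apply/rationalP; exists (tmap (@phi_ahom V) id (rho v)) => a /=.
rewrite rm_rhoM /tmap2; apply: eq_klift => a0 a1.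
rewrite klift_tmap //; apply: bilinP => [n|g]; last by lin.
by apply: lin_kpure_l; exact: ahom_ev_linear.
Qed.

Definition phi V (v : V) : aHOM regular V := AHOM (phi_rational v).

Lemma phi_linear V : linear (@phi V).
Proof. by move=> c x y; apply: val_inj; exact: phi_ahom_linear. Qed.

Lemma phi_coact V (v : V) : HOM_coact (phi v) (tmap (@phi V) id (rho v)).
Proof.
apply/HOM_coactP => a /=.
rewrite rm_rhoM /tmap2; apply: eq_klift => a0 a1.
rewrite klift_tmap //; apply: bilinP => [n|g]; last by lin.
by apply: lin_kpure_l => c x y.
Qed.

End RelCat.

Section Colinear.
Variables (k : comPzRingType) (H : hopf k) (A B : comodAlg H).
Variable T : functor (urelC A) (urelC B).

Definition Tobj (V : relmod A) : relmod B := fobj T V.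
Definition Tmap (V W : relmod A) (f : aHOM V W) : aHOM (Tobj V) (Tobj W) :=
  @fmap k _ _ T V W f.

(* The second part says (T \otimes H)(\rho(f)) = \rho(T(f)).                  *)
Definition Hcolinear : Prop :=
  forall V W : relmod A,
    linear (@Tmap V W) /\
    forall (f : aHOM V W) (t : aHOM V W ⊗ H),
      HOM_coact f t -> HOM_coact (Tmap f) (tmap (@Tmap V W) id t).

Hypothesis hT : Hcolinear.

Lemma Tmap_linear V W : linear (@Tmap V W).
Proof. by case: (hT V W). Qed.

Lemma Tmap_coact V W (f : aHOM V W) t :
  HOM_coact f t -> HOM_coact (Tmap f) (tmap (@Tmap V W) id t).
Proof. by case: (hT V W) => _; apply. Qed.

Lemma Tmap_comp V W X (g : aHOM W X) (f : aHOM V W) (m : Tobj V) :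
  Tmap (aHOM_comp g f) m = Tmap g (Tmap f m).
Proof. by rewrite /Tmap (@fmap_comp k _ _ T V W X g f). Qed.

Lemma Tmap_id V (m : Tobj V) : Tmap (aHOM_id V) m = m.
Proof. by rewrite /Tmap (fmap_id T V). Qed.

Lemma Tmap_colinear V W (f : amor V W) :
  aHOM_ahom (Tmap (amor_HOM f)) \in @colinear k H B (Tobj V) (Tobj W).
Proof.
apply: coact_colinear; have := Tmap_coact (amor_coact f).
by rewrite tmap_pure //; exact: Tmap_linear.
Qed.

Definition restr_map (V W : relmod A) (f : amor V W) : amor (Tobj V) (Tobj W) :=
  AMor (Tmap_colinear f).

Definition restr : functor (relC A) (relC B).
Proof.
refine (@Functor k (relC A) (relC B) Tobj restr_map _ _).
- by move=> V; apply: amor_ext => m /=; rewrite -[RHS](Tmap_id m);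
    congr (ahom_fun (aHOM_ahom (Tmap _)) m); exact: aHOM_ext.
- move=> V W X g f; apply: amor_ext => m /=; rewrite -Tmap_comp.
  by congr (ahom_fun (aHOM_ahom (Tmap _)) m); exact: aHOM_ext.
Defined.

End Colinear.

(* objects of {}_B M_A^H *)
Record bimod (k : comPzRingType) (H : hopf k) (B A : comodAlg H) := Bimod {
  bm_relmod :> relmod B;
  ract : bm_relmod -> A -> bm_relmod;
  bm_rmod : is_rmod ract;
  bm_act : forall b n a, b ▷ ract n a = ract (b ▷ n) a;
  bm_rhoM : forall n a, rho (ract n a) = tmap2 ract amul (rho n) (ca_rho a) }.

Arguments ract {k H B A b} : rename.
Notation "n ◁ a" := (ract n a) (at level 40, left associativity) : ring_scope.

Section BimodT.
Variables (k : comPzRingType) (H : hopf k) (A B : comodAlg H).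
Variable T : functor (urelC A) (urelC B).
Hypothesis hT : Hcolinear T.

Definition Tract (n : Tobj T (regular A)) (a : A) : Tobj T (regular A) :=
  Tmap T (phi (V := regular A) a) n.

Lemma Tract_rmod : is_rmod Tract.
Proof.
split.
- split=> [a|n]; first exact: ahom_linear.
  by move=> c x y; rewrite /Tract phi_linear (Tmap_linear hT).
- move=> n; rewrite -[RHS]Tmap_id /Tract.
  by congr (ahom_fun (aHOM_ahom (Tmap T _)) n); apply: aHOM_ext => a;
    exact: amul1r.
- move=> n a b; rewrite /Tract -Tmap_comp.
  congr (ahom_fun (aHOM_ahom (Tmap T _)) n); apply: aHOM_ext => x.
  exact: amulA.
Qed.

Lemma Tract_rho n a : rho (Tract n a) = tmap2 Tract amul (rho n) (ca_rho a).
Proof.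
have /HOM_coactP E := Tmap_coact hT (phi_coact (V := regular A) a).
rewrite /Tract E /tmap2; apply: eq_klift => n0 n1.
have b : bilin (fun (g : aHOM (Tobj T (regular A)) (Tobj T (regular A))) (h : H) => g n0 ⊗ (n1 ⊙ h)).
  by apply: bilinP => [h|g]; [apply: lin_kpure_l | lin].
rewrite !klift_tmap //; apply: bilinP => [h|g]; last by lin.
by apply: lin_kpure_l => c x y; rewrite (Tmap_linear hT).
Qed.

Definition bimodT : bimod B A.
Proof.
refine (@Bimod k H B A (Tobj T (regular A)) Tract Tract_rmod _ Tract_rho).
by move=> b n a; rewrite /Tract ahom_act.
Defined.

End BimodT.

Section TensorFunctor.
Variables (k : comPzRingType) (H : hopf k) (A B : comodAlg H) (N : bimod B A).
Implicit Types V W : relmod A.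

Definition tensA V : lmodType k :=
  tensor (@ract k H B A N) (@lact k H A V).

Definition apure V (n : N) (v : V) : tensA V :=
  tpure (@ract k H B A N) (@lact k H A V) n v.

Definition alift V (P : lmodType k) (b : N -> V -> P) (t : tensA V) : P :=
  tlift b t.

Definition abal V (P : lmodType k) (b : N -> V -> P) : Prop :=
  bilin b /\ forall n a v, b (n ◁ a) v = b n (a ▷ v).

Lemma abal_balanced V (P : lmodType k) (b : N -> V -> P) : abal b ->
  balanced (@ract k H B A N) (@lact k H A V) b.
Proof.
case=> [[bl br] bb]; split=> // m n n'; exact: (linD (br m)).
Qed.

Lemma alift_pure V (P : lmodType k) (b : N -> V -> P) n v :
  abal b -> alift b (apure n v) = b n v.
Proof. by move=> bb; exact: (tlift_pure (abal_balanced bb)). Qed.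

Lemma alift_linear V (P : lmodType k) (b : N -> V -> P) :
  abal b -> linear (alift b).
Proof. by move=> bb; exact: (tlift_linear (abal_balanced bb)). Qed.

Lemma lin_alift V (P Q : lmodType k) (b : N -> V -> P) (g : Q -> tensA V) :
  abal b -> linear g -> linear (fun x => alift b (g x)).
Proof. by move=> bb lg; apply: lin_comp lg; exact: alift_linear. Qed.

Lemma apureM V n a (v : V) : apure (n ◁ a) v = apure n (a ▷ v).
Proof. exact: tpure_bal. Qed.

Lemma lin_apure_l V (Q : lmodType k) (f : Q -> N) (v : V) :
  linear f -> linear (fun x => apure (f x) v).
Proof. exact: lin_tpure_l. Qed.

Lemma lin_apure_r V (Q : lmodType k) n (f : Q -> V) :
  linear f -> linear (fun x => apure n (f x)).
Proof.
move=> lf c x y; rewrite lf /apure tpure_Dr; congr (_ + _).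
have E : n ◁ (c *: (aone : A)) = c *: n.
  by rewrite (linZ ((rmod_bilin (bm_rmod N)).2 n)) (rmod_1 (bm_rmod N)).
have <- : c *: (aone : A) ▷ f x = c *: f x.
  by rewrite (linZ ((lmod_bilin (rm_lmod V)).1 (f x))) lact1.
rewrite -[LHS]apureM E; exact: tpure_Zl.
Qed.

Lemma apure_abal V : abal (@apure V).
Proof.
split; last by move=> *; exact: apureM.
by split=> *; [exact: lin_apure_l | exact: lin_apure_r].
Qed.

Lemma tensA_ext V (P : lmodType k) (f g : tensA V -> P) : linear f -> linear g ->
  (forall n v, f (apure n v) = g (apure n v)) -> forall t, f t = g t.
Proof. exact: tens_ext. Qed.

Ltac alin_step :=
  lazymatch goal with
  | |- forall _, _ => intro
  | |- bilin _ => apply: bilinP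
  | _ => first
    [ eassumption
    | exact: lin_id
    | apply: lin_apure_l
    | apply: lin_apure_r
    | lin_step ]
  end.
Ltac alin := repeat alin_step.

Definition tens_lact V (b : B) : tensA V -> tensA V :=
  alift (fun n v => apure (b ▷ n) v).

(* \rho(n \otimes v) = n_0 \otimes v_0 \otimes n_1 v_1 *)
Definition tens_rho V : tensA V -> tensA V ⊗ H :=
  alift (fun n v => tmap2 (@apure V) amul (rho n) (rho v)).

Lemma tens_lact_abal V b : abal (fun n (v : V) => apure (b ▷ n) v).
Proof.
split; first by alin.
by move=> n a v; rewrite bm_act apureM.
Qed.

Lemma tens_rho_abal V : abal (fun n (v : V) => tmap2 (@apure V) amul (rho n) (rho v)).
Proof.
split; first by rewrite /tmap2; alin.
move=> n a v; rewrite bm_rhoM rm_rhoM /tmap2 klift_klift; last by alin.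
apply: eq_klift => n0 n1; rewrite klift_klift; last by alin.
rewrite klift_klift; last by alin.
apply: eq_klift => a0 a1; rewrite klift_pure; last by alin.
rewrite klift_klift; last by alin.
apply: eq_klift => v0 v1; rewrite klift_pure; last by alin.
by rewrite apureM amulA.
Qed.

Lemma tens_lactE V b n (v : V) : tens_lact b (apure n v) = apure (b ▷ n) v.
Proof. by rewrite /tens_lact alift_pure //; exact: tens_lact_abal. Qed.

Lemma tens_rhoE V n (v : V) :
  tens_rho (apure n v) = tmap2 (@apure V) amul (rho n) (rho v).
Proof. by rewrite /tens_rho alift_pure //; exact: tens_rho_abal. Qed.

Lemma lin_tens_lact V (Q : lmodType k) b (f : Q -> tensA V) :
  linear f -> linear (fun x => tens_lact b (f x)).
Proof. by move=> lf; apply: lin_alift => //; exact: tens_lact_abal. Qed.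

Lemma lin_tens_rho V (Q : lmodType k) (f : Q -> tensA V) :
  linear f -> linear (fun x => tens_rho (f x)).
Proof. by move=> lf; apply: lin_alift => //; exact: tens_rho_abal. Qed.

Lemma tens_lact_bilin V : bilin (@tens_lact V).
Proof.
split=> [t|b]; last exact: lin_tens_lact (@lin_id _ _).
by apply: lin_tlift_fun => n v; alin.
Qed.

Lemma tens_lmod V : is_lmod (@tens_lact V).
Proof.
split; first exact: tens_lact_bilin.
- apply: tensA_ext => [||n v]; [|exact: lin_id|by rewrite tens_lactE lact1].
  exact: lin_tens_lact (@lin_id _ _).
- move=> a b; apply: tensA_ext => [||n v].
  + exact: lin_tens_lact (@lin_id _ _).
  + do 2 apply: lin_tens_lact; exact: lin_id.
  + by rewrite !tens_lactE lactM.
Qed.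

Lemma tens_comod V : is_comod comul counit (@tens_rho V).
Proof.
split; first exact: lin_tens_rho (@lin_id _ _).
- apply: tensA_ext => [||n v].
  + by rewrite /tassoc /tmap; alin; apply: lin_tens_rho; alin.
  + by rewrite /tmap; alin; apply: lin_tens_rho; alin.
  rewrite /tassoc klift_tmap; last by alin.
  rewrite tens_rhoE klift_tmap2; last first.
    by alin; apply: lin_tens_rho; alin.
  transitivity (klift (fun n0 n1 => klift (fun n00 n01 =>
     klift (fun v0 v1 => klift (fun v00 v01 =>
       apure n00 v00 ⊗ ((n01 ⊙ v01) ⊗ (n1 ⊙ v1))) (rho v0)) (rho v))
     (rho n0)) (rho n)).
    apply: eq_klift => n0 n1; rewrite -klift_exch; apply: eq_klift => v0 v1.
    rewrite tens_rhoE klift_tmap2; last by alin.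
    by apply: eq_klift => n00 n01; apply: eq_klift => v00 v01.
  rewrite (rho_sweedler (b := fun n00 n01 n1 => klift (fun v0 v1 =>
    klift (fun v00 v01 =>
       apure n00 v00 ⊗ ((n01 ⊙ v01) ⊗ (n1 ⊙ v1))) (rho v0)) (rho v))); try by alin.
  rewrite /tmap klift_tmap2; last by alin.
  apply: eq_klift => n0 n1.
  under eq_klift => g g' do
    (rewrite (rho_sweedler (b := fun v00 v01 v1 =>
       apure n0 v00 ⊗ ((g ⊙ v01) ⊗ (g' ⊙ v1)))); try by alin).
  rewrite klift_exch; apply: eq_klift => v0 v1 /=.
  have l : linear (fun w : H ⊗ H => apure n0 v0 ⊗ w) by alin.
  rewrite comulM /tmap2 (klift_out (f := fun w => apure n0 v0 ⊗ w)) //.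
  apply: eq_klift => g g'.
  by rewrite (klift_out (f := fun w => apure n0 v0 ⊗ w)).
- apply: tensA_ext => [||n v]; [|exact: lin_id|].
  + by alin; apply: lin_tens_rho; alin.
  rewrite tens_rhoE klift_tmap2; last by alin.
  rewrite -(rho_counit (f := fun n => apure n v)); last by alin.
  apply: eq_klift => n0 n1.
  rewrite -(rho_counit (f := fun v => counit n1 *: apure n0 v)); last by alin.
  by apply: eq_klift => v0 v1; rewrite counitM scalerA mulrC.
Qed.

Lemma tens_rhoM V b (t : tensA V) :
  tens_rho (tens_lact b t) = tmap2 (@tens_lact V) amul (ca_rho b) (tens_rho t).
Proof.
have l1 (Q : lmodType k) b' (f : Q -> tensA V) := @lin_tens_lact V Q b' f.
have l2 (Q : lmodType k) (f : Q -> B) t' :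
    linear f -> linear (fun x => tens_lact (f x) t' : tensA V).
  by move=> lf; exact: (lin_comp ((@tens_lact_bilin V).1 t') lf).
have l3 (Q : lmodType k) (f : Q -> tensA V) := @lin_tens_rho V Q f.
move: t; apply: tensA_ext => [||n v].
- by apply: l3; apply: l1; exact: lin_id.
- rewrite /tmap2; apply: lin_klift_fun => b0 b1; apply: lin_klift_arg.
    by apply: bilinP => [h|t]; alin; apply: l1; alin.
  by apply: l3; exact: lin_id.
rewrite tens_lactE !tens_rhoE rm_rhoM /tmap2 klift_klift; last by alin.
apply: eq_klift => b0 b1; rewrite !klift_klift; last 2 first.
- by alin; apply: l1; alin.
- by alin.
apply: eq_klift => n0 n1; rewrite klift_pure; last by alin.
rewrite klift_klift; last by alin; apply: l1; alin.
apply: eq_klift => v0 v1; rewrite klift_pure; last by alin; apply: l1; alin.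
by rewrite tens_lactE amulA.
Qed.

Definition tensObj V : relmod B :=
  @RelMod k H B (tensA V) (@tens_lact V) (@tens_rho V)
    (tens_lmod V) (tens_comod V) (@tens_rhoM V).

Lemma tens_map_abal V W (f : ahom V W) : abal (fun n v => apure n (f v)).
Proof.
split; last by move=> n a v; rewrite apureM ahom_act.
by alin.
Qed.

Lemma tens_map_alin V W (f : ahom V W) :
  (alift (fun n v => apure n (f v)) : tensObj V -> tensObj W)
    \in @alin k H B (tensObj V) (tensObj W).
Proof.
have l := alift_linear (tens_map_abal f).
apply: alinP => // b; apply: tensA_ext => [||n v].
- by apply: (lin_alift (tens_map_abal f)); exact: lin_tens_lact (@lin_id _ _).
- by apply: lin_tens_lact.
rewrite [_ ▷ _]tens_lactE !alift_pure; try exact: tens_map_abal.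
by rewrite [RHS]tens_lactE.
Qed.

Definition tens_ahom V W (f : ahom V W) : ahom (tensObj V) (tensObj W) :=
  AHom (tens_map_alin f).

Lemma tens_ahomE V W (f : ahom V W) n v :
  tens_ahom f (apure n v) = apure n (f v).
Proof. by rewrite [LHS]alift_pure //; exact: tens_map_abal. Qed.

Lemma tens_ahom_ext V (X : relmod B) (f g : ahom (tensObj V) X) :
  (forall n v, f (apure n v) = g (apure n v)) -> f = g.
Proof.
move=> fg; apply: ahom_ext; apply: tensA_ext => //.
  exact: (ahom_linear f).
exact: (ahom_linear g).
Qed.

Lemma tens_ahom_linear V W : linear (@tens_ahom V W).
Proof.
move=> c f g; apply: tens_ahom_ext => n v.
rewrite tens_ahomE.
transitivity (c *: tens_ahom f (apure n v) + tens_ahom g (apure n v)) => //.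
by rewrite !tens_ahomE; exact: (lin_apure_r n (@lin_id _ _)).
Qed.

Lemma tens_rational V W (f : aHOM V W) :
  tens_ahom f \in @rational k H B (tensObj V) (tensObj W).
Proof.
have /rationalP[t tP] := aHOMP f.
apply/rationalP; exists (tmap (@tens_ahom V W) id t).
have b1 m0 m1 : bilin (fun (g : ahom (tensObj V) (tensObj W)) (h : H) =>
    g m0 ⊗ (m1 ⊙ h)).
  by apply: bilinP; alin.
have b2 : bilin (fun (m0 : tensObj V) (m1 : H) =>
    klift (fun g h => (g : ahom (tensObj V) (tensObj W)) m0 ⊗ (m1 ⊙ h))
      (tmap (@tens_ahom V W) id t)).
  by alin.
apply: tensA_ext => [||n v].
- by apply: lin_rho; exact: (ahom_linear (tens_ahom f)).
- by apply: lin_klift_arg => //; exact: lin_tens_rho (@lin_id _ _).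
rewrite tens_ahomE [LHS]tens_rhoE [rho (apure n v : tensObj _)]tens_rhoE.
rewrite klift_tmap2 // /tmap2; apply: eq_klift => n0 n1.
rewrite tP klift_klift; last by alin.
apply: eq_klift => v0 v1; rewrite klift_klift; last by alin.
rewrite klift_tmap //; apply: eq_klift => g h.
rewrite klift_pure; last by alin.
by rewrite tens_ahomE amulA.
Qed.

Definition tens_aHOM V W (f : aHOM V W) : aHOM (tensObj V) (tensObj W) :=
  AHOM (tens_rational f).

Definition tensF : functor (urelC A) (urelC B).
Proof.
refine (@Functor k (urelC A) (urelC B) tensObj tens_aHOM _ _).
- by move=> V; apply: val_inj; apply: tens_ahom_ext => n v;
    exact: (tens_ahomE (ahom_id V)).
- move=> V W X g f; apply: val_inj; apply: tens_ahom_ext => n v.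
  rewrite [LHS](tens_ahomE (ahom_comp g f)).
  by rewrite [RHS](congr1 (tens_ahom g) (tens_ahomE f n v)) tens_ahomE.
Defined.

End TensorFunctor.

Section Psi.
Variables (k : comPzRingType) (H : hopf k) (A B : comodAlg H).
Variable T : functor (urelC A) (urelC B).
Hypothesis hT : Hcolinear T.
Local Notation N := (bimodT hT).
Implicit Types V W : relmod A.

Definition psi_fun V : tensObj N V -> Tobj T V :=
  alift (fun (n : N) v => Tmap T (phi v) n).

Lemma psi_abal V : abal (fun (n : N) (v : V) => Tmap T (phi v) n : Tobj T V).
Proof.
split=> [|n a v].
  split=> [v|n]; first exact: ahom_linear.
  by move=> c x y; rewrite phi_linear (Tmap_linear hT).
rewrite -[LHS]Tmap_comp; congr (ahom_fun (aHOM_ahom (Tmap T _)) n).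
by apply: aHOM_ext => x; exact: lactM.
Qed.

Lemma psi_funE V (n : N) (v : V) : psi_fun (apure n v) = Tmap T (phi v) n.
Proof. exact: (alift_pure _ _ (psi_abal V)). Qed.

Lemma psi_alin V : (@psi_fun V) \in @alin k H B (tensObj N V) (Tobj T V).
Proof.
have l := alift_linear (psi_abal V).
apply: alinP => // b; apply: tensA_ext => [||n v].
- by apply: (lin_alift (psi_abal V)); exact: lin_tens_lact (@lin_id _ _).
- by apply: lin_lact_r.
by rewrite [b ▷ (apure n v : tensObj _ _)]tens_lactE !psi_funE ahom_act.
Qed.

Definition psi_ahom V : ahom (tensObj N V) (Tobj T V) := AHom (psi_alin V).

Lemma psi_colinear V : psi_ahom V \in @colinear k H B (tensObj N V) (Tobj T V).
Proof.
apply/colinearP; apply: tensA_ext => [||n v].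
- by apply: lin_rho; exact: (ahom_linear (psi_ahom V)).
- apply: lin_tmap; [exact: (ahom_linear (psi_ahom V)) | exact: lin_id |].
  exact: lin_tens_rho (@lin_id _ _).
rewrite [psi_ahom V _]psi_funE [rho (apure n v : tensObj _ _)]tens_rhoE.
have /HOM_coactP -> := Tmap_coact hT (phi_coact v).
rewrite [RHS]klift_tmap2; last first.
  by apply: bilinP => [h|m]; [apply: lin_kpure_l; exact: ahom_linear | lin].
apply: eq_klift => n0 n1.
have b : bilin (fun (g : aHOM (Tobj T (regular A)) (Tobj T V)) (h : H) => g n0 ⊗ (n1 ⊙ h)).
  by apply: bilinP => [h|g]; [apply: lin_kpure_l | lin].
rewrite !klift_tmap //; last first.
  apply: bilinP => [h|g]; last by lin.
  by apply: lin_kpure_l => c x y; rewrite (Tmap_linear hT).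
by apply: eq_klift => v0 v1; rewrite [psi_ahom V _]psi_funE.
Qed.

Definition psi V : amor (tensObj N V) (Tobj T V) := AMor (psi_colinear V).

End Psi.

(* Main.v *)
From HB Require Import structures.
From mathcomp Require Import ssreflect ssrfun ssrbool eqtype choice ssrnat seq.
From mathcomp Require Import bigop ssralg.
From mathcomp Require Import boolp functions.
Require Import Defs.

Set Implicit Arguments.
Unset Strict Implicit.
Unset Printing Implicit Defensive.

Import GRing.Theory.
Local Open Scope ring_scope.

(** Write F = N ⊗_A -.  The functor T turns a colimit of copies of A into the
    corresponding colimit of copies of N, and so does F; since psi_A is the
    canonical isomorphism N ⊗_A A = N, the two functors agree on every object
    that is built from A by coproducts and cokernels.  The hypotheses on A and
    H say that all objects are built in this way.

    Because A is a generator, every V is a quotient of a coproduct of copies of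
    A, one for each morphism A -> V ([cover_surj]): otherwise the projection of
    V onto the cokernel of this coproduct and the zero map would be
    distinguished by no morphism A -> V.  Because H is projective, hence flat,
    over k, the kernel of that map is again a comodule ([ker_comod]), and is
    itself covered by copies of A.  This gives an exact sequence P1 -> P0 -> V
    -> 0 where P1 and P0 are coproducts of copies of A, and it presents V as a
    cokernel ([exact_cokernel]).

    As T preserves coproducts and cokernels, the universal properties of T(P),
    for P a coproduct of copies of A, and of T(V) yield the inverse of psi.  At
    P it sends T(inj_i)(n) to n ⊗ inj_i(1) ([psi_iso_coproduct]); at V it is
    induced by the inverse of psi at P0 followed by F(P0 -> V)
    ([psi_iso_cokernel]). *)

(** * Free modules *)

Section FreeModule.
Variables (k : comPzRingType) (I : choiceType).

Definition finsupp : {pred I -> k^o} :=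
  fun f => `[< exists s : seq I, forall i, i \notin s -> f i = 0 >].

Lemma finsupp_submod : submod_closed finsupp.
Proof.
split=> [|c f g /asboolP[s sP] /asboolP[t tP]]; apply/asboolP.
  by exists [::].
exists (s ++ t) => i; rewrite mem_cat negb_or => /andP[/sP fi /tP gi].
have -> : (c *: f + g) i = c *: f i + g i by [].
by rewrite fi gi scaler0 addr0.
Qed.

HB.instance Definition _ :=
  GRing.isSubmodClosed.Build k (I -> k^o) finsupp finsupp_submod.

Record free := Free { free_fun :> I -> k^o; freeP : free_fun \in finsupp }.

HB.instance Definition _ := [isSub for free_fun].
HB.instance Definition _ := [Choice of free by <:].
HB.instance Definition _ := [SubChoice_isSubLmodule of free by <:].

Definition supports (s : seq I) (x : free) : Prop :=
  forall i, i \notin s -> x i = 0.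

Lemma supp_ex (x : free) : exists s, supports s x.
Proof. by case: x => f fP; exact/asboolP. Qed.

Definition supp (x : free) : seq I := undup (sval (cid (supp_ex x))).

Lemma supp_uniq x : uniq (supp x).
Proof. exact: undup_uniq. Qed.

Lemma suppP x : supports (supp x) x.
Proof. 
by rewrite /supp; case: cid => s /= sP i; rewrite mem_undup; apply: sP.
Qed.

Lemma basis_finsupp i : (fun j => (j == i)%:R : k^o) \in finsupp.
Proof.
by apply/asboolP; exists [:: i] => j; rewrite inE => /negbTE ->.
Qed.

Definition basis i : free := Free (basis_finsupp i).

Definition free_lift (M : lmodType k) (u : I -> M) (x : free) : M :=
  \sum_(i <- supp x) x i *: u i.

(** Linearity of the lift compares sums over the supports of different elements;
    this allows one common sequence for all of them. *)
Lemma free_liftE (M : lmodType k) (u : I -> M) (x : free) s :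
  uniq s -> supports s x -> free_lift u x = \sum_(i <- s) x i *: u i.
Proof.
move=> us sx.
have main (s1 s2 : seq I) : uniq s1 -> uniq s2 -> supports s1 x ->
    supports s2 x -> \sum_(i <- s1) x i *: u i
      = \sum_(i <- s1 | i \in s2) x i *: u i.
  move=> u1 u2 p1 p2; rewrite (bigID (mem s2)) /= [X in _ + X]big1 ?addr0 //.
  by move=> i /p2 ->; rewrite scale0r.
rewrite /free_lift (main (supp x) s) ?(main s (supp x)) ?supp_uniq //;
  try exact: suppP.
rewrite -[LHS]big_filter -[RHS]big_filter; apply: perm_big; apply: uniq_perm.
- by rewrite filter_uniq ?supp_uniq.
- by rewrite filter_uniq.
- by move=> i; rewrite !mem_filter andbC.
Qed.

Lemma free_lift_linear (M : lmodType k) (u : I -> M) : linear (free_lift u).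
Proof.
move=> c x y; set s := undup (supp x ++ supp y).
have sx : supports s x.
  by move=> i; rewrite mem_undup mem_cat negb_or => /andP[/suppP].
have sy : supports s y.
  by move=> i; rewrite mem_undup mem_cat negb_or => /andP[_ /suppP].
have sE i : (c *: x + y) i = c * x i + y i by [].
have sxy : supports s (c *: x + y).
  by move=> i si; rewrite sE (sx i si) (sy i si) mulr0 addr0.
rewrite !(@free_liftE _ _ _ s) ?undup_uniq //.
rewrite scaler_sumr -big_split /=; apply: eq_bigr => i _.
by rewrite -[LHS]/((c * x i + y i) *: u i) scalerDl scalerA.
Qed.

Lemma free_lift_basis (M : lmodType k) (u : I -> M) i :
  free_lift u (basis i) = u i.
Proof.
rewrite (@free_liftE _ _ _ [:: i]) //; last first.
  by move=> j; rewrite inE /= => /negbTE ->.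
by rewrite big_seq1 /= eqxx scale1r.
Qed.

Lemma free_ext (M : lmodType k) (f g : free -> M) : linear f -> linear g ->
  (forall i, f (basis i) = g (basis i)) -> forall x, f x = g x.
Proof.
move=> lf lg fg x.
have -> : x = free_lift basis x.
  apply: val_inj; apply/funext => j /=.
  have l : linear (fun y : free => y j : k^o) by [].
  transitivity (\sum_(i <- supp x) (x i *: basis i : free) j : k^o); last first.
    exact: esym (lin_sum l _ _).
  have E i : (x i *: basis i : free) j = (x i : k) * (j == i)%:R by [].
  under eq_bigr do rewrite E.
  have [js|js] := boolP (j \in supp x).
    rewrite (bigD1_seq j) ?supp_uniq //= big1 ?addr0 ?eqxx ?mulr1 //.
    by move=> i ij; rewrite eq_sym (negbTE ij) mulr0.
  rewrite (suppP js) big_seq big1 // => i si.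
  by case: eqP si js => [-> ->//|_ _ _]; rewrite mulr0.
rewrite /free_lift (lin_sum lf) (lin_sum lg); apply: eq_bigr => i _.
by rewrite (linZ lf) (linZ lg) fg.
Qed.

End FreeModule.

Arguments basis {k I} i.

(** * Flatness of projective modules *)

Section Flat.
Variables (k : comPzRingType) (H : lmodType k).
Hypothesis projH : projective H.
Implicit Types M N W P : lmodType k.

Lemma kpure_sumr M N (m : M) (J : Type) (r : seq J) (F : J -> N) :
  m ⊗ (\sum_(j <- r) F j) = \sum_(j <- r) m ⊗ F j.
Proof.
exact: (lin_sum (f := fun n => m ⊗ n) (lin_kpure_r m (@lin_id k N))).
Qed.

Lemma kpure_scale M N c (m : M) (n : N) : (c *: m) ⊗ n = m ⊗ (c *: n).
Proof.
rewrite (linZ (lin_kpure_l n (@lin_id _ _))).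
by rewrite [RHS](linZ (lin_kpure_r m (@lin_id _ _))).
Qed.

(** Lifting the identity of H along the free module on the set H gives a dual
    basis: the coordinates of d x are the functionals, indexed by H itself, and
    the element that goes with the index y is y. *)
Lemma projective_section : exists d : H -> free k H,
  linear d /\ forall x, free_lift (fun y : H => y) (d x) = x.
Proof.
pose s := free_lift (fun y : H => y).
pose sL := GRing.isLinear.Build _ _ _ _ s (@free_lift_linear k H H _).
pose g : {linear free k H -> H} := HB.pack s sL.
have [|d dP] := @projH _ _ g idfun.
  by move=> y; exists (basis y); exact: free_lift_basis.
by exists d; split=> // c x y; rewrite linearP.
Qed.

Definition coords : H -> free k H := sval (cid projective_section).

Lemma coords_linear : linear coords.
Proof. by rewrite /coords; case: cid => d []. Qed.

Lemma coordsK x : free_lift (fun y : H => y) (coords x) = x.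
Proof. by rewrite /coords; case: cid => d []. Qed.

(** The contraction M ⊗ H -> M with the functional of index i of the dual basis. *)
Definition contract M (i : H) : M ⊗ H -> M :=
  klift (fun m x => (coords x i : k) *: m).

Lemma contract_bilin M (i : H) : bilin (fun (m : M) x => (coords x i : k) *: m).
Proof.
split=> [x|m]; first exact: lin_Z (@lin_id _ _).
by apply: lin_Zl => c x y; rewrite coords_linear.
Qed.

Lemma contract_tmap M N (f : M -> N) i t : linear f ->
  contract i (tmap f id t) = f (contract i t).
Proof.
move=> lf; rewrite /contract klift_tmap; last exact: contract_bilin.
rewrite (klift_out (f := f)) //; apply: eq_klift => m x.
by rewrite (linZ lf).
Qed.

(** A tensor is determined by its contractions.  Since contractions commute with
    [tmap f id], every question on M ⊗ H is thereby reduced to one on M, which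
    is how flatness of H is obtained below. *)
Lemma tens_contract M (t : M ⊗ H) :
  exists s : seq H, t = \sum_(i <- s) contract i t ⊗ i.
Proof.
pose s := undup (flatten [seq supp (coords p.2) | p <- trepr t]).
exists s; rewrite {1}(tens_sum t).
have E i : contract i t ⊗ i
    = \sum_(p <- trepr t) (((coords p.2 i : k) *: p.1) ⊗ i).
  by rewrite (lin_sum (lin_kpure_l i (@lin_id _ _))).
under [RHS]eq_bigr do rewrite E.
rewrite exchange_big /=; apply: eq_big_seq => p pt.
rewrite -[X in tpure _ _ _ X]coordsK (@free_liftE _ _ _ _ _ s) ?undup_uniq //.
  rewrite -[LHS]/(kpure _ _) kpure_sumr; apply: eq_bigr => i _.
  by rewrite kpure_scale.
move=> i; rewrite mem_undup => /flattenP ni; apply: suppP; apply/negP => ip.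
by case: ni; exists (supp (coords p.2)) => //; apply/mapP; exists p.
Qed.

Lemma tmap_inj M N (f : M -> N) : linear f -> injective f ->
  injective (tmap f id : M ⊗ H -> N ⊗ H).
Proof.
move=> lf fI t t' E.
have lT : linear (tmap f id : M ⊗ H -> N ⊗ H).
  by apply: lin_tmap => //; exact: lin_id.
apply/eqP; rewrite -subr_eq0; apply/eqP.
have [s ->] := tens_contract (t - t').
apply: big1 => i _; rewrite -(lin0 (lin_kpure_l i (@lin_id _ _))).
congr (_ ⊗ _); apply: fI; rewrite (lin0 lf) -contract_tmap //.
have -> : t - t' = - t' + t by rewrite addrC.
rewrite -scaleN1r lT E scaleN1r addNr.
exact: (lin0 (klift_linear (contract_bilin N i))).
Qed.

(** The tensor product with H twice, in the bracketing in which coassociativity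
    is stated. *)
Lemma tmap_assoc_inj M N (f : M -> N) : linear f -> injective f ->
  injective (tmap f id : M ⊗ (H ⊗ H) -> N ⊗ (H ⊗ H)).
Proof.
pose unassoc (P : lmodType k) : P ⊗ (H ⊗ H) -> (P ⊗ H) ⊗ H :=
  klift (fun m w => klift (fun g h => (m ⊗ g) ⊗ h) w).
have ub (P : lmodType k) :
    bilin (fun (m : P) w => klift (fun (g h : H) => (m ⊗ g) ⊗ h) w) by lin.
have unassocE (P : lmodType k) (m : P) g h : unassoc P (m ⊗ (g ⊗ h)) = (m ⊗ g) ⊗ h.
  by rewrite /unassoc klift_pure // klift_pure //; lin.
have ul (P : lmodType k) : linear (unassoc P) by exact: klift_linear.
have unassocK (P : lmodType k) : cancel (unassoc P) (@tassoc k P H H).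
  move=> t; rewrite -[RHS]klift_kpure /unassoc /tassoc klift_klift; last by lin.
  apply: eq_klift => m w; rewrite klift_klift; last by lin.
  have l : linear (fun w : H ⊗ H => m ⊗ w) by lin.
  rewrite -[X in _ = _ ⊗ X]klift_kpure (klift_out (f := fun w => m ⊗ w)) //.
  apply: eq_klift => g h; rewrite klift_pure; last by lin.
  by rewrite klift_pure //; lin.
move=> lf fI t t' E; rewrite -[t]unassocK -[t']unassocK; congr (tassoc _).
have lf1 : linear (tmap f id : M ⊗ H -> N ⊗ H).
  by apply: lin_tmap => //; exact: lin_id.
apply: (tmap_inj lf1 (tmap_inj lf fI)).
suff nat u : tmap (tmap f id) id (unassoc M u) = unassoc N (tmap f id u).
  by rewrite !nat E.
rewrite /unassoc klift_tmap // [LHS]klift_klift; last by lin.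
apply: eq_klift => m w; rewrite klift_klift; last by lin.
by apply: eq_klift => g h; rewrite klift_pure ?tmap_pure //; lin.
Qed.

(** Tensoring with H preserves kernels: the contractions of t are killed by p,
    so they lift to M, and the lifts reassemble to a tensor over t. *)
Lemma tmap_exact M N W (f : M -> N) (p : N -> W) (t : N ⊗ H) :
    linear f -> linear p -> (forall y, p y = 0 -> exists x, f x = y) ->
  tmap p id t = 0 -> exists s : M ⊗ H, tmap f id s = t.
Proof.
move=> lf lp ex pt.
have pc i : p (contract i t) = 0.
  rewrite -contract_tmap // pt.
  exact: (lin0 (klift_linear (contract_bilin W i))).
have [s ->] := tens_contract t.
pose c i : M := sval (cid (ex _ (pc i))).
have cE i : f (c i) = contract i t by rewrite /c; case: cid.
exists (\sum_(i <- s) c i ⊗ i).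
have lT : linear (tmap f id : M ⊗ H -> N ⊗ H).
  by apply: lin_tmap => //; exact: lin_id.
rewrite (lin_sum lT); apply: eq_bigr => i _.
by rewrite tmap_pure // ?cE //; exact: lin_id.
Qed.

End Flat.

(** * Coproducts of copies of a relative Hopf module *)

(** X ⊗ V with the action and the coaction of V.  For X free on I this is the
    coproduct of I copies of V; this form reduces the relative Hopf module
    axioms to those of V on pure tensors. *)
Section Copower.
Variables (k : comPzRingType) (H : hopf k) (A : comodAlg H).
Variables (X : lmodType k) (V : relmod A).

Definition copower_act (a : A) : X ⊗ V -> X ⊗ V := klift (fun x v => x ⊗ (a ▷ v)).

Definition copower_rho : X ⊗ V -> (X ⊗ V) ⊗ H :=
  klift (fun x v => klift (fun v0 h => (x ⊗ v0) ⊗ h) (rho v)).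

Lemma copower_actE a x v : copower_act a (x ⊗ v) = x ⊗ (a ▷ v).
Proof. by rewrite /copower_act klift_pure //; lin. Qed.

Lemma copower_rhoE x v :
  copower_rho (x ⊗ v) = klift (fun v0 h => (x ⊗ v0) ⊗ h) (rho v).
Proof. by rewrite /copower_rho klift_pure //; lin. Qed.

Lemma lin_copower_act (Q : lmodType k) a (f : Q -> X ⊗ V) :
  linear f -> linear (fun q => copower_act a (f q)).
Proof. by move=> lf; rewrite /copower_act; lin. Qed.

Lemma lin_copower_rho (Q : lmodType k) (f : Q -> X ⊗ V) :
  linear f -> linear (fun q => copower_rho (f q)).
Proof. by move=> lf; rewrite /copower_rho; lin. Qed.

Lemma copower_act_bilin : bilin copower_act.
Proof. by rewrite /copower_act; lin. Qed.

Lemma copower_lmod : is_lmod copower_act.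
Proof.
split; first exact: copower_act_bilin.
- apply: ktens_ext => [||x v]; [exact: copower_act_bilin.2|exact: lin_id|].
  by rewrite copower_actE lact1.
- move=> a b; apply: ktens_ext => [||x v]; first exact: copower_act_bilin.2.
    by do 2 apply: lin_copower_act; exact: lin_id.
  by rewrite !copower_actE lactM.
Qed.

Lemma copower_comod : is_comod comul counit copower_rho.
Proof.
split; first exact: lin_copower_rho (@lin_id _ _).
- apply: ktens_ext => [||x v].
  + by rewrite /tassoc /tmap; lin; apply: lin_copower_rho; lin.
  + by rewrite /tmap; lin; apply: lin_copower_rho; lin.
  rewrite copower_rhoE /tassoc klift_tmap; last by lin.
  rewrite klift_klift; last by lin; apply: lin_copower_rho; lin.
  transitivity (klift (fun v0 h => klift (fun v00 h0 =>
      (x ⊗ v00) ⊗ (h0 ⊗ h)) (rho v0)) (rho v)).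
    apply: eq_klift => v0 h.
    rewrite klift_pure; last by lin; apply: lin_copower_rho; lin.
    rewrite copower_rhoE klift_klift; last by lin.
    by apply: eq_klift => v00 h0; rewrite klift_pure //; lin.
  rewrite (rho_sweedler (b := fun y g h => (x ⊗ y) ⊗ (g ⊗ h))); [|by lin..].
  rewrite /tmap klift_klift; last by lin.
  apply: eq_klift => v0 h; rewrite klift_pure; last by lin.
  have l : linear (fun w : H ⊗ H => (x ⊗ v0) ⊗ w) by lin.
  by rewrite -(klift_out (f := fun w => (x ⊗ v0) ⊗ w)) ?klift_kpure.
- apply: ktens_ext => [||x v]; [|exact: lin_id|].
    by lin; apply: lin_copower_rho; lin.
  rewrite copower_rhoE klift_klift; last by lin.
  rewrite -(rho_counit (f := fun v => x ⊗ v)); last by lin.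
  by apply: eq_klift => v0 h; rewrite klift_pure //; lin.
Qed.

Lemma copower_rhoM a t :
  copower_rho (copower_act a t) = tmap2 copower_act amul (ca_rho a) (copower_rho t).
Proof.
have l1 (Q : lmodType k) a' (f : Q -> X ⊗ V) := @lin_copower_act Q a' f.
have l3 (Q : lmodType k) (f : Q -> X ⊗ V) := @lin_copower_rho Q f.
move: t; apply: ktens_ext => [||x v].
- by apply: l3; apply: l1; exact: lin_id.
- rewrite /tmap2; apply: lin_klift_fun => b0 b1; apply: lin_klift_arg.
    by apply: bilinP => [h|t]; lin; apply: l1; lin.
  by apply: l3; exact: lin_id.
rewrite copower_actE !copower_rhoE rm_rhoM /tmap2 klift_klift; last by lin.
apply: eq_klift => b0 b1; rewrite !klift_klift; last 2 first.
- by lin; apply: l1; lin.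
- by lin.
apply: eq_klift => v0 v1; rewrite klift_pure; last by lin.
by rewrite klift_pure ?copower_actE //; lin; apply: l1; lin.
Qed.

Definition copower : relmod A :=
  RelMod copower_lmod copower_comod copower_rhoM.

End Copower.

Section Coproduct.
Variables (k : comPzRingType) (H : hopf k) (A : comodAlg H).
Variables (I : choiceType) (V : relmod A).
Local Notation P := (copower (free k I) V).

(** The tensors basis i ⊗ v, that is the images of the injections, span. *)
Lemma copower_ext (M : lmodType k) (f g : P -> M) : linear f -> linear g ->
  (forall i v, f (basis i ⊗ v) = g (basis i ⊗ v)) -> forall t, f t = g t.
Proof.
move=> lf lg fg; apply: ktens_ext => // x v.
move: x; apply: free_ext => [||i]; last exact: fg.
- by apply: (lin_comp (f := f)) => //; exact: lin_kpure_l (@lin_id _ _).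
- by apply: (lin_comp (f := g)) => //; exact: lin_kpure_l (@lin_id _ _).
Qed.

Lemma copower_inj_alin (i : I) : (fun v => basis i ⊗ v : P) \in @alin k H A V P.
Proof.
apply: alinP => [|a v]; first exact: lin_kpure_r (@lin_id _ _).
exact: esym (copower_actE _ _ _).
Qed.

Lemma copower_inj_colinear (i : I) :
  AHom (copower_inj_alin i) \in @colinear k H A V P.
Proof. by apply/colinearP => v; exact: copower_rhoE. Qed.

Definition copower_inj i : amor V P := AMor (copower_inj_colinear i).

Variables (Z : relmod A) (g : I -> amor V Z).

Definition copower_desc_fun : P -> Z :=
  klift (fun x v => free_lift (fun i => g i v) x).

Lemma copower_desc_bilin :
  bilin (fun (x : free k I) (v : V) => free_lift (fun i => g i v) x).
Proof.
split=> [v|x]; first exact: free_lift_linear.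
move=> c v w; rewrite /free_lift scaler_sumr -big_split /=.
apply: eq_bigr => i _; rewrite ahom_linear scalerDr !scalerA.
by rewrite [c * _]mulrC.
Qed.

Lemma copower_desc_funE i v : copower_desc_fun (basis i ⊗ v) = g i v.
Proof.
rewrite /copower_desc_fun klift_pure; last exact: copower_desc_bilin.
exact: free_lift_basis.
Qed.

Lemma copower_desc_linear : linear copower_desc_fun.
Proof. exact: klift_linear copower_desc_bilin. Qed.

Lemma copower_desc_alin : copower_desc_fun \in @alin k H A P Z.
Proof.
apply: alinP => [|a]; first exact: copower_desc_linear.
apply: copower_ext => [||i v].
- by apply: (lin_comp copower_desc_linear); exact: lin_lact_r (@lin_id _ _).
- by apply: lin_lact_r; exact: copower_desc_linear.
by rewrite [a ▷ (_ : P)]copower_actE !copower_desc_funE ahom_act.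
Qed.

Lemma copower_desc_colinear : AHom copower_desc_alin \in @colinear k H A P Z.
Proof.
apply/colinearP; apply: copower_ext => [||i v].
- by apply: lin_rho; exact: copower_desc_linear.
- by apply: lin_tmap; [exact: copower_desc_linear|exact: lin_id|];
    exact: lin_rho (@lin_id _ _).
rewrite [X in tmap _ _ X]copower_rhoE [AHom _ _]copower_desc_funE.
have /colinearP -> := amorP (g i).
have bl : bilin (fun (t : P) (h : H) => copower_desc_fun t ⊗ h).
  apply: bilinP => [h|t]; last exact: lin_kpure_r (@lin_id _ _).
  exact: lin_kpure_l copower_desc_linear.
rewrite /tmap klift_klift //; apply: eq_klift => v0 h.
by rewrite klift_pure // [AHom _ _]copower_desc_funE.
Qed.

Definition copower_desc : amor P Z := AMor copower_desc_colinear.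

Lemma copower_descE i v : copower_desc (basis i ⊗ v : P) = g i v.
Proof. exact: copower_desc_funE. Qed.

End Coproduct.

Lemma copower_is_coproduct (k : comPzRingType) (H : hopf k) (A : comodAlg H)
    (I : choiceType) (V : relmod A) :
  is_coproduct (C := relC A) (X := fun _ : I => V) (P := copower (free k I) V)
    (fun i => copower_inj V i).
Proof.
move=> Z g; exists (copower_desc g); split=> [i|h hE].
  by apply: amor_ext => v; exact: copower_descE.
apply: amor_ext; apply: copower_ext => [||i v]; try exact: ahom_linear.
by rewrite copower_descE -hE.
Qed.

(** * Cokernels *)

Section CokernelModule.
Variables (k : comPzRingType) (U V : lmodType k) (f : U -> V).
Hypothesis lf : linear f.

(** The cokernel of f as the tensor product V ⊗ k over the set k × U, where (a, u)
    acts on V by v |-> a v + f u and on k by c |-> a c.  The pairs (a, 0) make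
    the product balanced over k, and the pairs (1, u) kill the image of f. *)
Definition coker : lmodType k :=
  tensor (N := k^o) (fun (v : V) (x : k * U) => x.1 *: v + f x.2)
    (fun (x : k * U) c => x.1 *: c).

Definition coker_class (v : V) : coker := tpure _ _ v (1 : k^o).

Lemma coker_bal a v u (c : k^o) :
  tpure _ _ (a *: v + f u) c = tpure _ _ v (a *: c) :> coker.
Proof.
exact: (tpure_bal (fun (v : V) (x : k * U) => x.1 *: v + f x.2)
  (fun (x : k * U) (c : k^o) => x.1 *: c) v (a, u) c).
Qed.

Lemma coker_class_linear : linear coker_class.
Proof. exact: lin_tpure_l (@lin_id _ _). Qed.

Lemma coker_class0 u : coker_class (f u) = 0.
Proof.
have := coker_bal 1 0 u 1; rewrite !scale1r add0r => E.
exact: etrans E (lin0 coker_class_linear).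
Qed.

Lemma coker_ext (M : lmodType k) (g h : coker -> M) : linear g -> linear h ->
  (forall v, g (coker_class v) = h (coker_class v)) -> forall t, g t = h t.
Proof.
move=> lg lh gh; apply: tens_ext => // v c.
have := coker_bal c v 0 1; rewrite (lin0 lf) addr0 [c *: (1 : k^o)]mulr1 => <-.
exact: gh.
Qed.

Definition coker_lift (M : lmodType k) (g : V -> M) : coker -> M :=
  tlift (fun v (c : k^o) => (c : k) *: g v).

Section Lift.
Variables (M : lmodType k) (g : V -> M).
Hypotheses (lg : linear g) (gf0 : forall u, g (f u) = 0).

Lemma coker_lift_balanced :
  balanced (N := k^o) (fun (v : V) (x : k * U) => x.1 *: v + f x.2)
    (fun (x : k * U) c => x.1 *: c) (fun v (c : k^o) => (c : k) *: g v).
Proof.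
split=> [c|v c d|v [a u] c /=]; first exact: lin_Z.
- by rewrite scalerDl.
- by rewrite lg gf0 addr0 scalerA [c * a]mulrC.
Qed.

Lemma coker_lift_linear : linear (coker_lift g).
Proof. exact: tlift_linear coker_lift_balanced. Qed.

Lemma coker_liftE v : coker_lift g (coker_class v) = g v.
Proof. by rewrite /coker_lift (tlift_pure coker_lift_balanced) scale1r. Qed.

End Lift.

(** Only the image of f is killed: each generator of the congruence that defines
    the tensor product changes the sum of the c v, over the terms (v, c) of a
    formal sum, by an element of the image of f. *)
Lemma coker_class_eq0 v : coker_class v = 0 -> exists u, f u = v.
Proof.
pose ev (s : seq (V * k^o)) : V := \sum_(p <- s) (p.2 : k) *: p.1.
have fD := linD lf; have f0 := lin0 lf; have fZ := linZ lf.
suff main s t :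
  tens_rel (N := k^o) (fun (v : V) (x : k * U) => x.1 *: v + f x.2)
    (fun (x : k * U) c => x.1 *: c) s t -> exists u, ev s = ev t + f u.
  move/tclassP => /main[u].
  by rewrite /ev big_seq1 big_nil add0r scale1r /= => ->; exists u.
elim=> {s t} /=.
- by move=> s; exists 0; rewrite f0 addr0.
- move=> s t _ [u ->]; exists (-1 *: u).
  by rewrite fZ -addrA scaleN1r addrN addr0.
- by move=> s t w _ [u ->] _ [u' ->]; exists (u' + u); rewrite fD addrA.
- move=> s s' t t' _ [u E] _ [u' E']; exists (u + u').
  by rewrite /ev !big_cat /= -!/(ev _) E E' fD addrACA.
- by move=> s t; exists 0; rewrite /ev !big_cat /= addrC f0 addr0.
- by move=> c; exists 0; rewrite /ev big_seq1 big_nil /= scaler0 f0 addr0.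
- move=> w w' c; exists 0.
  by rewrite /ev !big_cons !big_nil /= scalerDr f0 !addr0.
- move=> w c d; exists 0.
  by rewrite /ev !big_cons !big_nil /= scalerDl f0 !addr0.
- move=> c w [a u] d; exists (d *: (c *: u)).
  rewrite /ev !big_seq1 /= !fZ !scalerDr !scalerA.
  by rewrite -[a *: d]/(a * d) mulrAC [a * d]mulrC.
Qed.

End CokernelModule.

(** For a morphism f of relative Hopf modules, action and coaction descend to the
    cokernel because f commutes with them. *)
Section CokernelRelmod.
Variables (k : comPzRingType) (H : hopf k) (A : comodAlg H).
Variables (U V : relmod A) (f : amor U V).
Local Notation Q := (coker f).
Local Notation cls := (@coker_class k U V f).
Let lf : linear f := ahom_linear f.

Lemma lin_coker_class (R : lmodType k) (g : R -> V) :
  linear g -> linear (fun x => cls (g x)).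
Proof. by move=> lg; exact: (lin_comp (@coker_class_linear _ _ _ f) lg). Qed.

Definition coker_act (a : A) : Q -> Q := coker_lift (fun v => cls (a ▷ v)).
Definition coker_rho : Q -> Q ⊗ H := coker_lift (fun v => tmap cls id (rho v)).

Lemma coker_act_lift_linear a : linear (fun v => cls (a ▷ v)).
Proof. by apply: lin_coker_class; exact: lin_lact_r (@lin_id _ _). Qed.

Lemma coker_act_lift0 a u : cls (a ▷ f u) = 0.
Proof. by rewrite -ahom_act coker_class0. Qed.

Lemma coker_rho_lift_linear : linear (fun v => tmap cls id (rho v)).
Proof.
apply: lin_tmap; [exact: coker_class_linear|exact: lin_id|].
exact: lin_rho (@lin_id _ _).
Qed.

Lemma coker_rho_lift0 u : tmap cls id (rho (f u)) = 0.
Proof.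
have /colinearP -> := amorP f.
rewrite [LHS]klift_tmap; last by lin; exact: lin_coker_class.
rewrite /klift /tlift big1 // => p _; rewrite coker_class0.
exact: (lin0 (lin_kpure_l p.2 (@lin_id _ _))).
Qed.

Lemma coker_actE a v : coker_act a (cls v) = cls (a ▷ v).
Proof.
by apply: coker_liftE; [exact: coker_act_lift_linear|exact: coker_act_lift0].
Qed.

Lemma coker_rhoE v : coker_rho (cls v) = tmap cls id (rho v).
Proof.
by apply: coker_liftE; [exact: coker_rho_lift_linear|exact: coker_rho_lift0].
Qed.

Lemma lin_coker_act (R : lmodType k) a (g : R -> Q) :
  linear g -> linear (fun x => coker_act a (g x)).
Proof.
move=> lg; apply: lin_comp lg; apply: coker_lift_linear.
  exact: coker_act_lift_linear.
exact: coker_act_lift0.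
Qed.

Lemma lin_coker_rho (R : lmodType k) (g : R -> Q) :
  linear g -> linear (fun x => coker_rho (g x)).
Proof.
move=> lg; apply: lin_comp lg; apply: coker_lift_linear.
  exact: coker_rho_lift_linear.
exact: coker_rho_lift0.
Qed.

Lemma coker_act_bilin : bilin coker_act.
Proof.
split=> [t|a]; last exact: lin_coker_act (@lin_id _ _).
apply: lin_tlift_fun => v c; apply: lin_Z.
by apply: lin_coker_class; exact: lin_lact_l (@lin_id _ _).
Qed.

Lemma coker_lmod : is_lmod coker_act.
Proof.
split; first exact: coker_act_bilin.
- apply: (coker_ext lf) => [||v]; [exact: coker_act_bilin.2|exact: lin_id|].
  by rewrite coker_actE lact1.
- move=> a b; apply: (coker_ext lf) => [||v]; first exact: coker_act_bilin.2.
    by do 2 apply: lin_coker_act; exact: lin_id.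
  by rewrite !coker_actE lactM.
Qed.

Lemma coker_comod : is_comod comul counit coker_rho.
Proof.
have lr := lin_coker_rho (@lin_id k Q).
split=> //.
- apply: (coker_ext lf) => [||v].
  + by rewrite /tassoc /tmap; lin.
  + by rewrite /tmap; lin.
  have lc := @coker_class_linear _ _ _ f.
  rewrite coker_rhoE /tassoc klift_tmap; last by lin.
  rewrite /tmap !klift_klift; try by lin.
  transitivity (klift (fun v0 h => klift (fun v00 h0 =>
      cls v00 ⊗ (h0 ⊗ h)) (rho v0)) (rho v)).
    apply: eq_klift => v0 h; rewrite klift_pure; last by lin.
    rewrite coker_rhoE [LHS]klift_tmap //; by lin.
  rewrite (rho_sweedler (b := fun y g h => cls y ⊗ (g ⊗ h))); last by lin.
    apply: eq_klift => v0 h; rewrite klift_pure; last by lin.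
    have l : linear (fun w : H ⊗ H => cls v0 ⊗ w) by lin.
    by rewrite -(klift_out (f := fun w => cls v0 ⊗ w)) ?klift_kpure.
  by move=> g h; apply: lin_kpure_l; apply: lin_coker_class; exact: lin_id.
- apply: (coker_ext lf) => [||v]; [by lin|exact: lin_id|].
  rewrite coker_rhoE klift_tmap; last by lin.
  exact: (rho_counit (f := cls) v (@coker_class_linear _ _ _ f)).
Qed.

Lemma coker_rhoM a t :
  coker_rho (coker_act a t) = tmap2 coker_act amul (ca_rho a) (coker_rho t).
Proof.
have lc := @coker_class_linear _ _ _ f.
have b2 (b0 : A) (b1 : H) :
    bilin (fun (t : Q) (h : H) => coker_act b0 t ⊗ (b1 ⊙ h)).
  apply: bilinP => [h|u]; last by lin.
  by apply: lin_kpure_l; exact: lin_coker_act (@lin_id _ _).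
move: t; apply: (coker_ext lf) => [||v].
- by apply: lin_coker_rho; apply: lin_coker_act; exact: lin_id.
- rewrite /tmap2; apply: lin_klift_fun => b0 b1; apply: lin_klift_arg => //.
  exact: lin_coker_rho (@lin_id _ _).
rewrite coker_actE !coker_rhoE rm_rhoM [LHS]klift_tmap2; last first.
  by apply: bilinP => [h|u]; [exact: lin_kpure_l|lin].
rewrite /tmap2; apply: eq_klift => b0 b1; rewrite klift_tmap //.
by apply: eq_klift => v0 v1; rewrite coker_actE.
Qed.

Definition coker_relmod : relmod A := RelMod coker_lmod coker_comod coker_rhoM.

Lemma coker_proj_alin : cls \in @alin k H A V coker_relmod.
Proof.
apply: alinP => [|a v]; first exact: coker_class_linear.
exact: esym (coker_actE _ _).
Qed.

Lemma coker_proj_colinear :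
  AHom coker_proj_alin \in @colinear k H A V coker_relmod.
Proof. by apply/colinearP => v; exact: coker_rhoE. Qed.

Definition coker_proj : amor V coker_relmod := AMor coker_proj_colinear.

End CokernelRelmod.

(** * Kernels *)

Section Kernel.
Variables (k : comPzRingType) (H : hopf k) (A : comodAlg H).
Variables (V W : relmod A) (p : amor V W).

Definition ker_pred : {pred V} := fun v => p v == 0.

Lemma ker_submod : submod_closed ker_pred.
Proof.
split=> [|c v w /eqP pv /eqP pw]; apply/eqP; first exact: lin0 (ahom_linear p).
by rewrite ahom_linear pv pw scaler0 addr0.
Qed.

HB.instance Definition _ :=
  GRing.isSubmodClosed.Build k V ker_pred ker_submod.

Record ker := Ker { ker_val :> V; kerP : ker_val \in ker_pred }.

HB.instance Definition _ := [isSub for ker_val].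
HB.instance Definition _ := [Choice of ker by <:].
HB.instance Definition _ := [SubChoice_isSubLmodule of ker by <:].

Lemma ker_val_linear : linear ker_val.
Proof. by []. Qed.

Lemma ker_val_inj : injective ker_val.
Proof. exact: val_inj. Qed.

Lemma ker_val0 (x : ker) : p x = 0.
Proof. exact/eqP/(kerP x). Qed.

Lemma ker_val_ex v : p v = 0 -> exists x : ker, ker_val x = v.
Proof. by move=> /eqP pv; exists (@Ker v pv). Qed.

Lemma ker_act_subproof a (x : ker) : a ▷ ker_val x \in ker_pred.
Proof.
apply/eqP; rewrite ahom_act ker_val0.
exact: (lin0 (lin_lact_r a (@lin_id _ _))).
Qed.

Definition ker_act a x : ker := Ker (ker_act_subproof a x).

Hypothesis projH : projective H.

(** The coaction of V maps the kernel of p into the kernel of p ⊗ H, because p is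
    colinear; by flatness the latter is the kernel of p tensored with H. *)
Lemma ker_rho_subproof (x : ker) :
  exists t : ker ⊗ H, tmap ker_val id t = rho (ker_val x).
Proof.
apply: (tmap_exact projH ker_val_linear (ahom_linear p) ker_val_ex).
have /colinearP <- := amorP p.
by rewrite ker_val0; exact: (lin0 (lin_rho (@lin_id _ _))).
Qed.

Definition ker_rho (x : ker) : ker ⊗ H := sval (cid (ker_rho_subproof x)).

Lemma ker_rhoE x : tmap ker_val id (ker_rho x) = rho (ker_val x).
Proof. by rewrite /ker_rho; case: cid. Qed.

Lemma lin_tmap_ker : linear (tmap ker_val id : ker ⊗ H -> V ⊗ H).
Proof.
by apply: lin_tmap; [exact: ker_val_linear|exact: lin_id|exact: lin_id].
Qed.

Lemma tmap_ker_inj : injective (tmap ker_val id : ker ⊗ H -> V ⊗ H).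
Proof. exact: (tmap_inj projH ker_val_linear ker_val_inj). Qed.

Lemma ker_rho_linear : linear ker_rho.
Proof.
move=> c x y; apply: tmap_ker_inj.
rewrite lin_tmap_ker !ker_rhoE ker_val_linear.
exact: (lin_rho (@lin_id _ _)).
Qed.

Lemma ker_lmod : is_lmod ker_act.
Proof.
split.
- split=> [x|a] c u v; apply: ker_val_inj.
    exact: (lin_lact_l (ker_val x) (@lin_id _ A) c u v).
  exact: (lin_lact_r a (@lin_id _ V) c (ker_val u) (ker_val v)).
- by move=> x; apply: ker_val_inj; exact: lact1.
- by move=> a b x; apply: ker_val_inj; exact: lactM.
Qed.

(** The identities hold in V, and the flatness of H makes ker ⊗ H and
    ker ⊗ (H ⊗ H) embed into V ⊗ H and V ⊗ (H ⊗ H). *)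
Lemma ker_comod : is_comod comul counit ker_rho.
Proof.
have lv := ker_val_linear; have lr := ker_rho_linear.
split=> // x; last first.
  apply: ker_val_inj; rewrite (klift_out (f := ker_val)) //.
  rewrite -[RHS](rho_counit (f := fun v : V => v)); last exact: lin_id.
  rewrite -ker_rhoE klift_tmap //; by lin.
(* Both sides become the two iterated coactions of x as an element of V. *)
apply: (tmap_assoc_inj projH lv ker_val_inj).
transitivity (tassoc (tmap rho id (rho (ker_val x)))).
  rewrite -ker_rhoE /tassoc !klift_tmap; try by lin.
  rewrite klift_out; last first.
    by rewrite /tmap; lin.
  apply: eq_klift => y h; rewrite -ker_rhoE klift_tmap; last by lin.
  rewrite klift_out; last by rewrite /tmap; lin.
  by apply: eq_klift => z g; rewrite tmap_pure.
rewrite (comod_coassoc (rm_comod V)) -ker_rhoE /tmap !klift_klift; try by lin.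
by apply: eq_klift => y h; rewrite !klift_pure //; lin.
Qed.

Lemma ker_rhoM a x :
  ker_rho (ker_act a x) = tmap2 ker_act amul (ca_rho a) (ker_rho x).
Proof.
apply: tmap_ker_inj; rewrite ker_rhoE rm_rhoM -ker_rhoE.
have ba : bilin ker_act by exact: lmod_bilin ker_lmod.
rewrite [RHS]klift_tmap2; last by lin; exact: ker_val_linear.
rewrite /tmap2; apply: eq_klift => b0 b1; rewrite klift_tmap //; by lin.
Qed.

Definition ker_relmod : relmod A := RelMod ker_lmod ker_comod ker_rhoM.

Lemma ker_inj_alin : ker_val \in @alin k H A ker_relmod V.
Proof. by apply: alinP => [|a v //]; exact: ker_val_linear. Qed.

Lemma ker_inj_colinear : AHom ker_inj_alin \in @colinear k H A ker_relmod V.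
Proof. by apply/colinearP => v; exact: esym (ker_rhoE v). Qed.

Definition ker_inj : amor ker_relmod V := AMor ker_inj_colinear.

End Kernel.

(** * Presentations by copies of A *)

Section Presentation.
Variables (k : comPzRingType) (H : hopf k) (A : comodAlg H).
Implicit Types U V W : relmod A.

Definition cover V : relmod A :=
  copower (free k (amor (regular A) V)) (regular A).

Definition cover_map V : amor (cover V) V := copower_desc id.

(** The map from V to the cokernel of the covering vanishes on the image of every
    morphism A -> V, so it is zero since A is a generator. *)
Lemma cover_surj V : generator (C := relC A) (regular A) ->
  forall v : V, exists x, cover_map V x = v.
Proof.
move=> gen v; apply: (coker_class_eq0 (ahom_linear (cover_map V))).
suff E : coker_proj (cover_map V) = 0.
  exact: (congr1 (fun g : amor _ _ => g v) E).
apply: (gen V (coker_relmod (cover_map V))) => h; apply: amor_ext => a.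
rewrite /= -[h a](copower_descE id h a).
exact: coker_class0 (basis h ⊗ a : cover V).
Qed.

(** Elementwise exactness suffices: a map that kills the image of f is constant on
    the fibres of q, and what it induces on W is linear and colinear because q
    is a surjective morphism. *)
Lemma exact_cokernel U V W (f : amor U V) (q : amor V W) :
    (forall w, exists v, q v = w) -> (forall u, q (f u) = 0) ->
    (forall v, q v = 0 -> exists u, f u = v) ->
  is_cokernel (C := relC A) f q.
Proof.
move=> qs qf qe; split=> [|Z g gf]; first exact: amor_ext.
have g0 u : g (f u) = 0 by exact: (congr1 (fun h : amor U Z => h u) gf).
pose h w := g (sval (cid (qs w))).
have hq v : h (q v) = g v.
  rewrite /h; case: cid => v' /= E.
  have [u uE] : exists u, f u = v - v'.
    by apply: qe; rewrite (linD (ahom_linear q)) -scaleN1r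
      (linZ (ahom_linear q)) E scaleN1r addrN.
  rewrite -[v](subrK v') -uE (linD (ahom_linear g)) g0 add0r //.
have hl : linear h.
  move=> c x y; have [v <-] := qs x; have [w <-] := qs y.
  by rewrite -(ahom_linear q) !hq (ahom_linear g).
have ha a w : h (a ▷ w) = a ▷ h w.
  by have [v <-] := qs w; rewrite -ahom_act !hq ahom_act.
have hc : AHom (alinP hl ha) \in @colinear k H A W Z.
  apply/colinearP => w; have [v <-] := qs w.
  have /colinearP -> := amorP q.
  rewrite [AHom _ _]hq; have /colinearP -> := amorP g.
  rewrite [RHS]klift_tmap.
    by apply: eq_klift => v0 v1; rewrite -hq.
  by apply: bilinP => [z|z]; [exact: lin_kpure_l|exact: lin_kpure_r (@lin_id _ _)].
exists (AMor hc); split=> [|h' h'E].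
  by apply: amor_ext => v; exact: hq.
apply: amor_ext => w; have [v <-] := qs w; rewrite [LHS]hq.
by rewrite -h'E.
Qed.

End Presentation.

(** * The tensor functor on colinear maps *)

Section TensorMorphisms.
Variables (k : comPzRingType) (H : hopf k) (A B : comodAlg H) (N : bimod B A).
Implicit Types V W : relmod A.

Lemma tens_colinear V W (f : amor V W) :
  tens_ahom N f \in @colinear k H B (tensObj N V) (tensObj N W).
Proof.
have lf := ahom_linear (tens_ahom N f).
apply/colinearP; apply: tensA_ext => [||n v].
- exact: lin_rho.
- apply: lin_tmap => //; exact: lin_tens_rho (@lin_id _ _).
rewrite tens_ahomE [LHS]tens_rhoE [rho (apure n v : tensObj _ _)]tens_rhoE.
have /colinearP -> := amorP f.
rewrite [RHS]klift_tmap2; last first.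
  by apply: bilinP => [h|t]; [exact: lin_kpure_l|exact: lin_kpure_r (@lin_id _ _)].
apply: eq_klift => n0 n1; rewrite klift_tmap; last first.
  by lin; apply: lin_apure_r; exact: lin_id.
by apply: eq_klift => v0 v1; rewrite tens_ahomE.
Qed.

Definition tens_amor V W (f : amor V W) : amor (tensObj N V) (tensObj N W) :=
  AMor (tens_colinear f).

Lemma tens_one_alin :
  (fun n : N => apure n (aone : regular A))
    \in @alin k H B N (tensObj N (regular A)).
Proof.
apply: alinP => [|b n]; first exact: lin_apure_l (@lin_id _ _).
exact: esym (tens_lactE _ _ _).
Qed.

Lemma tens_one_colinear :
  AHom tens_one_alin \in @colinear k H B N (tensObj N (regular A)).
Proof.
apply/colinearP => n; rewrite [LHS]tens_rhoE [X in tmap2 _ _ _ X]ca_rho1.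
rewrite /tmap2 /tmap; apply: eq_klift => n0 n1.
by rewrite klift_pure ?amul1r //; lin; apply: lin_apure_r; exact: lin_id.
Qed.

Definition tens_one : amor N (tensObj N (regular A)) := AMor tens_one_colinear.

End TensorMorphisms.

(** * The natural transformation psi *)

Section PsiIso.
Variables (k : comPzRingType) (H : hopf k) (A B : comodAlg H).
Variables (T : functor (urelC A) (urelC B)) (hT : Hcolinear T).
Implicit Types V W : relmod A.
Local Notation N := (bimodT hT).

Lemma psiE V (n : N) (v : V) : psi hT V (apure n v) = Tmap T (phi v) n.
Proof. exact: psi_funE. Qed.

Lemma psi_natural V W (f : aHOM V W) (t : tensObj N V) :
  psi hT W (tens_aHOM N f t) = Tmap T f (psi hT V t).
Proof.
move: t; apply: tensA_ext => [||n v].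
- exact: (lin_comp (ahom_linear (psi hT W)) (ahom_linear (tens_aHOM N f))).
- exact: (lin_comp (ahom_linear (Tmap T f)) (ahom_linear (psi hT V))).
rewrite [tens_aHOM _ _ _]tens_ahomE !psiE -Tmap_comp.
congr (ahom_fun (aHOM_ahom (Tmap T _)) n); apply: aHOM_ext => a /=.
exact: esym (ahom_act f a v).
Qed.

(** An A-linear map out of A is determined by its value at 1. *)
Lemma phi_one V (h : aHOM (regular A) V) : phi (h (aone : A)) = h.
Proof.
apply: aHOM_ext => a /=; rewrite -ahom_act; congr (ahom_fun _ _).
exact: amul1r.
Qed.

(** The inverse th is the morphism T(V) -> N ⊗_A V that the coproduct T(V) induces
    from the maps n |-> n ⊗ inj_i(1).  On n ⊗ inj_i(a) the composite of psi and
    th is (n a) ⊗ inj_i(1) = n ⊗ inj_i(a), and such tensors span. *)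
Lemma psi_iso_coproduct (I : Type) V (inj : I -> amor (regular A) V) :
    is_coproduct (C := relC B)
      (fun i => fmap (restr hT) (inj i : hom (k0 := relC A) _ _)) ->
    (forall (M : lmodType k) (f g : V -> M), linear f -> linear g ->
      (forall i a, f (inj i a) = g (inj i a)) -> forall v, f v = g v) ->
  is_iso (C := relC B) (psi hT V).
Proof.
move=> cop ext.
pose g i : amor (Tobj T (regular A)) (tensObj N V) :=
  amor_comp (tens_amor N (inj i)) (tens_one N).
have [th [thE _]] := cop (tensObj N V) g.
have {}thE i (n : N) :
    th (Tmap T (amor_HOM (inj i)) n) = apure n (inj i (aone : A)).
  transitivity (tens_amor N (inj i) (tens_one N n)).
    exact: (congr1 (fun h : amor _ _ => h n) (thE i)).
  exact: (tens_ahomE (inj i) n (aone : regular A)).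
exists th; split; last first.
  have [u [_ uU]] := cop (Tobj T V) (fun i => restr_map hT (inj i)).
  transitivity u; [apply: esym; apply: uU|apply: uU] => i; apply: amor_ext => n //.
  transitivity (psi hT V (th (Tmap T (amor_HOM (inj i)) n))) => //.
  rewrite thE psiE.
  by rewrite -[inj i _]/(amor_HOM (inj i) _) phi_one.
pose thp := amor_comp th (psi hT V).
apply: (@amor_ext _ _ _ _ _ thp); apply: tensA_ext => [||n].
- exact: (ahom_linear thp).
- exact: lin_id.
apply: (ext _ (fun v => thp (apure n v)) (fun v => apure n v)) => [||i a].
- apply: (lin_comp (ahom_linear thp)); exact: lin_apure_r (@lin_id _ _).
- exact: lin_apure_r (@lin_id _ _).
transitivity (th (psi hT V (apure n (inj i a)))) => //; rewrite psiE.
have -> : phi (inj i a) = aHOM_comp (amor_HOM (inj i)) (phi (a : regular A)).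
  by apply: aHOM_ext => b /=; rewrite -ahom_act.
rewrite Tmap_comp thE -[Tmap _ _ _]/(@ract _ _ _ _ N n a) apureM -ahom_act.
by congr (apure n (inj i _)); exact: amul1r.
Qed.

(** The inverse th is induced by the map T(V0) = N ⊗_A V0 -> N ⊗_A V, which
    vanishes on T(V1) since psi identifies T(f) with N ⊗_A f. *)
Lemma psi_iso_cokernel V1 V0 V (f : amor V1 V0) (q : amor V0 V) :
    (forall v, exists x, q x = v) -> (forall u, q (f u) = 0) ->
    is_cokernel (C := relC B) (fmap (restr hT) (f : hom (k0 := relC A) _ _))
      (fmap (restr hT) (q : hom (k0 := relC A) _ _)) ->
    is_iso (C := relC B) (psi hT V1) -> is_iso (C := relC B) (psi hT V0) ->
  is_iso (C := relC B) (psi hT V).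
Proof.
move=> qs qf [cok0 cok] [b1 [_ pb1]] [b0 [bp0 pb0]].
have pK1 x : psi hT V1 (b1 x) = x by exact: (congr1 (fun h : amor _ _ => h x) pb1).
have bK0 x : b0 (psi hT V0 x) = x by exact: (congr1 (fun h : amor _ _ => h x) bp0).
have pK0 x : psi hT V0 (b0 x) = x by exact: (congr1 (fun h : amor _ _ => h x) pb0).
have nf t : psi hT V0 (tens_amor N f t) = Tmap T (amor_HOM f) (psi hT V1 t).
  exact: (psi_natural (amor_HOM f)).
have nq t : psi hT V (tens_amor N q t) = Tmap T (amor_HOM q) (psi hT V0 t).
  exact: (psi_natural (amor_HOM q)).
have qf0 t : tens_amor N q (tens_amor N f t) = 0.
  have l0 : linear (fun _ : tensObj N V1 => 0 : tensObj N V).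
    by move=> c x y; rewrite scaler0 addr0.
  move: t; apply: tensA_ext => [||n v] //.
    exact: (ahom_linear (amor_comp (tens_amor N q) (tens_amor N f))).
  rewrite [tens_amor _ f _]tens_ahomE [LHS]tens_ahomE qf.
  exact: (lin0 (lin_apure_r n (@lin_id _ _))).
pose g : amor (Tobj T V0) (tensObj N V) := amor_comp (tens_amor N q) b0.
have [|th [thE _]] := cok _ g.
  apply: amor_ext => x; rewrite -[x]pK1.
  transitivity (tens_amor N q (b0 (Tmap T (amor_HOM f) (psi hT V1 (b1 x))))) => //.
  by rewrite -nf bK0; exact: qf0.
have {}thE x : th (Tmap T (amor_HOM q) x) = tens_amor N q (b0 x).
  exact: (congr1 (fun h : amor _ _ => h x) thE).
exists th; split.
  pose thp := amor_comp th (psi hT V).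
  apply: (@amor_ext _ _ _ _ _ thp); apply: tensA_ext => [||n v].
  - exact: (ahom_linear thp).
  - exact: lin_id.
  have [x <-] := qs v; rewrite -(tens_ahomE (N := N) q).
  transitivity (th (psi hT V (tens_amor N q (apure n x)))) => //.
  by rewrite nq thE bK0.
have [u [_ uU]] := cok (Tobj T V) (restr_map hT q) cok0.
transitivity u; [apply: esym; apply: uU|apply: uU]; apply: amor_ext => x //.
transitivity (psi hT V (th (Tmap T (amor_HOM q) x))) => //.
by rewrite thE nq pK0.
Qed.

Lemma psi_iso V : projective H -> generator (C := relC A) (regular A) ->
    preserves_cokernels (restr hT) -> preserves_coproducts (restr hT) ->
  is_iso (C := relC B) (psi hT V).
Proof.
move=> projH gen cok cop.
have free_iso I : is_iso (C := relC B) (psi hT (copower (free k I) (regular A))).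
  apply: (psi_iso_coproduct (inj := copower_inj (regular A))).
    exact: (cop _ _ _ _ (@copower_is_coproduct k H A I (regular A))).
  by move=> M f g; exact: copower_ext.
pose q := cover_map V; pose K := ker_relmod q projH.
pose f := amor_comp (ker_inj q projH) (cover_map K).
have qs := cover_surj gen (V := V); have Ks := cover_surj gen (V := K).
have qf u : q (f u) = 0 by exact: ker_val0.
apply: (psi_iso_cokernel qs qf) (free_iso _) (free_iso _).
apply: cok; apply: exact_cokernel => // v qv.
have [x <-] := ker_val_ex qv; have [u <-] := Ks x.
by exists u.
Qed.

End PsiIso.

Theorem proposition8p3 (k : comPzRingType) (H : hopf k) (projH : projective H)
    (A B : comodAlg H)
    (T : functor (urelC A) (urelC B)) (hT : Hcolinear T)
    (genA : generator (C := relC A) (regular A))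
    (cokT : preserves_cokernels (restr hT))
    (copT : preserves_coproducts (restr hT)) :
  natural_iso (F := tensF (bimodT hT)) (G := T)
    (fun V : relmod A => amor_HOM (psi hT V)) /\
  forall V : relmod A, is_iso (C := relC B) (psi hT V).
Proof.
have iso V := psi_iso V projH genA cokT copT.
split=> //; split=> [V W f|V]; first by apply: aHOM_ext => t; exact: psi_natural.
have [g [gp pg]] := iso V; exists (amor_HOM g).
by split; apply: aHOM_ext => x;
  [exact: (congr1 (fun h : amor _ _ => h x) gp)
  |exact: (congr1 (fun h : amor _ _ => h x) pg)].
Qed.
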